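(* Let $T$ be a torus of $SL_n(\mathbb{C})$, i.e. a commutative reductive complex Lie subgroup, and let $D$ be an infinite discrete subset of $T$. Then $D$ is a tame discrete subset of $X=SL_n(\mathbb{C})$.
   Context: A discrete subset of a complex manifold $X$ is a subset without accumulation points in $X$. An automorphism of $X$ is a biholomorphic self-map of the complex manifold $X$ (not necessarily a group homomorphism when $X$ is a Lie group). An exhaustion function on $X$ is a continuous function $\rho:X\to\mathbb{R}^+$ (non-negative reals) all of whose sublevel sets $\{x\in X:\rho(x)\le c\}$ are compact. An infinite discrete subset $D\subset X$ is called tame if for every exhaustion function $\rho:X\to\mathbb{R}^+$ and every map $\zeta:D\to\mathbb{R}^+$ there exists an automorphism $\phi$ of $X$ such that $\rho(\phi(x))\ge\zeta(x)$ for all $x\in D$. Torus is meant in the sense of algebraic groups: every torus is contained in a maximal torus, and a maximal torus is a conjugate of the group of diagonal matrices of determinant $1$. *)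

(* Defs.v *)
From HB Require Import structures.
From mathcomp Require Import all_boot all_order all_algebra.
From mathcomp Require Import complex.
From mathcomp Require Import all_classical all_reals all_analysis.
From mathcomp Require mpoly.
(* The notations of mpoly clash with those of analysis; its canonical
   structures do not. *)
Import -(notations) mpoly.

Set Implicit Arguments.
Unset Strict Implicit.
Unset Printing Implicit Defensive.

Import Order.TTheory GRing.Theory Num.Theory numFieldNormedType.Exports.
Local Open Scope classical_set_scope.
Local Open Scope ring_scope.
Local Open Scope complex_scope.

(* An embedded complex submanifold X of a complex normed space V is given by
   its carrier; maps on X are represented by maps on V whose values outside X
   are irrelevant. *)
Section EmbeddedManifold.
Variables (R : realType) (V : normedModType R[i]) (X : set V).
Implicit Types (D : set V) (f phi psi : V -> V) (rho zeta : V -> R).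

(* [differentiable] is Frechet differentiability over the scalar field R[i],
   that is, complex differentiability.  A map into X is holomorphic for the
   induced complex structure iff it is locally the restriction of a map that
   is holomorphic on an open subset of V. *)
Definition holomorphic_on f : Prop :=
  forall x, X x -> exists F : V -> V,
    (\forall y \near x, differentiable F y) /\
    (\forall y \near x, X y -> F y = f y).

Definition automorphism phi : Prop :=
  exists psi,
    [/\ (forall x, X x -> X (phi x)) /\ (forall x, X x -> X (psi x)),
        (forall x, X x -> psi (phi x) = x) /\
        (forall x, X x -> phi (psi x) = x),
        holomorphic_on phi & holomorphic_on psi].

Definition exhaustion rho : Prop :=
  [/\ {within X, continuous rho},
      (forall x, X x -> 0 <= rho x) &
      forall c : R, compact (X `&` [set x | rho x <= c])].

Definition discrete_subset D : Prop :=
  D `<=` X /\ forall x, X x -> ~ limit_point D x.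

Definition tame D : Prop :=
  [/\ infinite_set D, discrete_subset D &
      forall rho zeta, exhaustion rho -> (forall x, D x -> 0 <= zeta x) ->
        exists2 phi, automorphism phi & forall x, D x -> zeta x <= rho (phi x)].

End EmbeddedManifold.

Section LinearAlgebraicGroups.
Variables (R : realType) (n : nat).
Local Notation C := R[i].
Implicit Types (A B : 'M[C]_n) (Z T U : set 'M[C]_n).

Definition SL : set 'M[C]_n := [set A | \det A = 1].

Definition subgroup_of_SL T : Prop :=
  [/\ T `<=` SL, T 1%:M, (forall A B, T A -> T B -> T (A *m B)) &
      forall A, T A -> T (invmx A)].

(* The variables of the polynomials are the n * n matrix entries. *)
Definition zariski_closed Z : Prop :=
  exists S : set (mpoly (n * n) C),
    Z = [set A | forall p, S p -> meval (fun k => mxvec A 0 k) p = 0].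

(* Closedness in the n x n matrices and in SL_n agree for subsets of SL_n. *)
Definition algebraic_subgroup T : Prop := subgroup_of_SL T /\ zariski_closed T.

Definition zariski_connected U : Prop :=
  forall Z1 Z2, zariski_closed Z1 -> zariski_closed Z2 ->
    U `<=` Z1 `|` Z2 -> U `&` Z1 `&` Z2 = set0 -> U `<=` Z1 \/ U `<=` Z2.

Definition unipotent U : Prop :=
  forall A, U A -> exists k : nat, (A - 1%:M) ^+ k = 0.

Definition normal_in U T : Prop :=
  U `<=` T /\ forall A B, T A -> U B -> U (A *m B *m invmx A).

Definition commutative T : Prop := forall A B, T A -> T B -> A *m B = B *m A.

(* The unipotent radical, i.e. the largest connected normal unipotent algebraic
   subgroup, is trivial. *)
Definition reductive T : Prop :=
  forall U, algebraic_subgroup U -> normal_in U T -> zariski_connected U ->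
    unipotent U -> U = [set 1%:M].

(* Reductive complex Lie subgroups of SL_n are algebraic.  Connectedness is not
   required, so all diagonalizable subgroups are included. *)
Definition torus T : Prop :=
  [/\ algebraic_subgroup T, commutative T & reductive T].

End LinearAlgebraicGroups.

Arguments SL : clear implicits.

(* Main.v *)
Require Import Defs.
From HB Require Import structures.
From mathcomp Require Import all_boot all_order all_algebra.
From mathcomp Require Import ring lra.
From mathcomp Require Import complex.
From mathcomp Require Import all_classical all_reals all_analysis.
From mathcomp Require mpoly.
Import -(notations) mpoly.
Import numFieldNormedType.Exports.
Import Order.TTheory GRing.Theory Num.Theory.
Set Implicit Arguments.
Unset Strict Implicit.
Unset Printing Implicit Defensive.
Local Open Scope classical_set_scope.
Local Open Scope ring_scope.
Local Open Scope complex_scope.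

(** A torus T is simultaneously diagonalizable, so for a suitable column v (the
    sum of a basis of common eigenvectors) the orbit map A |-> A v embeds T
    linearly into C^n: A is recovered from A v by reading off its eigenvalues
    ([torus_orbit]).  Hence a discrete subset D of T becomes a sequence of
    distinct vectors A v that tends to infinity in C^n.

    Fix a row u != 0 with u v = 0; it exists since D is infinite, whence n >= 2.
    For every entire function f on C^n the shear A |-> A + f(A v) (A v) u
    multiplies A on the right by 1 + f(A v) v u.  It does not change A v, so it is
    an automorphism of SL_n with inverse the shear of -f
    ([shear_automorphism]).  On D the values of f can be prescribed at will
    ([entire_interpolation]), because the vectors A v are distinct and discrete
    in C^n; as (A v) u != 0, this moves every point of D as far away as desired.
    Sublevel sets of an exhaustion function are compact, hence bounded, so this
    is tameness.

    Two ingredients need work.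

    Diagonalizability.  Let A = S (1 + M) be the multiplicative Jordan
    decomposition of A in T, with S diagonalizable and M nilpotent.  A polynomial
    p vanishing on T vanishes at A^k = S^k (1 + M)^k, and p (S^k (1 + M)^t) is
    an exponential polynomial in (k, t); vanishing for t = k it vanishes
    identically, by independence of the functions k |-> a^k k^j.  At k = 0 this
    puts the one-parameter group t |-> (1 + M)^t into T.  If M were nonzero,
    that group would be a nontrivial connected unipotent algebraic subgroup,
    normal because T is commutative, against reductivity
    ([torus_diagonalizable]).  Commuting diagonalizable matrices are
    simultaneously diagonalizable.

    Interpolation.  The function f is the sum of a series of polynomials P_k,
    where P_k vanishes at the points preceding the k-th one, corrects the value at
    the k-th point d_k, and carries a high power of a coordinate divided by
    its value at d_k, which makes it small on a ball whose radius grows with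
    |d_k|.  Differentiability of the sum is obtained without integral formulas, from
    second-order Taylor estimates that are uniform on balls, stable under sums
    and products, and preserved by pointwise limits ([jet_bound]). *)

(** * Independence of exponential sums, and Jordan decomposition *)

Lemma poly_nat_roots0 (F : numFieldType) (p : {poly F}) :
  (forall k : nat, p.[k%:R] = 0) -> p = 0.
Proof.
move=> p0; apply: (@roots_geq_poly_eq0 _ p [seq k%:R | k <- iota 0 (size p)]).
- by apply/allP => _ /mapP[k _ ->]; apply/rootP.
- by rewrite map_inj_uniq ?iota_uniq// => a b /eqP; rewrite eqr_nat => /eqP.
- by rewrite size_map size_iota.
Qed.

(** Induction on the total size of the coefficients.  If [q a != 0], the operator
    [g |-> g (k + 1) - a g k] keeps the shape of the sum, lowers the degree of
    the coefficient at [a], and preserves the degree at every [b != a], because it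
    multiplies the leading coefficient by [b - a]. *)
Lemma exp_poly_independent (F : numFieldType) (s : seq F) (q : F -> {poly F}) :
  uniq s -> 0 \notin s ->
  (forall k : nat, \sum_(a <- s) a ^+ k * (q a).[k%:R] = 0) ->
  {in s, forall a, q a = 0}.
Proof.
move=> us s0; have [N] := ubnP (\sum_(a <- s) size (q a))%N.
elim: N q => // N IHN q; rewrite ltnS => szq q0 a as_.
apply/eqP/negP => /negP qa0.
have lcX : lead_coef ('X + 1%:P : {poly F}) = 1 by rewrite lead_coefXaddC.
have szX : size ('X + 1%:P : {poly F}) = 2%N by rewrite size_XaddC.
(* The coefficient at b of the sum g (k + 1) - a g k. *)
pose q' b := b *: (q b \Po ('X + 1%:P)) - a *: q b.
have szcomp b : size (q b \Po ('X + 1%:P)) = size (q b) by exact: size_comp_poly2.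
have leadq' b : (q' b)`_(size (q b)).-1 = (b - a) * lead_coef (q b).
  rewrite /q' coefB !coefZ -[in (q b \Po _)`_ _]szcomp -/(lead_coef _).
  by rewrite lead_coef_comp ?szX// lcX expr1n mulr1 lead_coefE mulrBl.
have szq' b : (size (q' b) <= size (q b))%N.
  apply: (leq_trans (size_polyD _ _)); rewrite size_polyN geq_max.
  by rewrite -{1}szcomp !size_scale_leq.
have q'0 : {in s, forall b, q' b = 0}.
  apply: IHN => [|k].
    apply: leq_trans szq; rewrite !(big_rem a as_) /=.
    rewrite -addSn leq_add//; last by apply: leq_sum => b _; exact: szq'.
    have := szq' a; rewrite leq_eqVlt => /orP[/eqP sz|//].
    have := leadq' a; rewrite subrr mul0r -sz -lead_coefE => /eqP.
    rewrite lead_coef_eq0 => /eqP q'a; move: sz qa0; rewrite q'a size_poly0.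
    by move/esym/eqP; rewrite size_poly_eq0 => ->.
  transitivity (\sum_(b <- s) b ^+ k.+1 * (q b).[k.+1%:R] -
                a * \sum_(b <- s) b ^+ k * (q b).[k%:R]); last by rewrite !q0 mulr0 subr0.
  rewrite mulr_sumr -sumrB; apply: eq_bigr => b _.
  rewrite /q' hornerD hornerN !hornerZ horner_comp hornerD hornerX hornerC.
  by rewrite -natr1 exprSr; ring.
have qb0 b : b \in s -> b != a -> q b = 0.
  move=> bs ba; have := leadq' b; rewrite q'0// coef0 => /esym/eqP.
  by rewrite mulf_eq0 subr_eq0 (negbTE ba) /= lead_coef_eq0 => /eqP.
case/negP: qa0; apply/eqP/poly_nat_roots0 => k.
have := q0 k; rewrite (big_rem a as_) /= big_seq big1 ?addr0.
  move/eqP; rewrite mulf_eq0 => /orP[|/eqP//].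
  by rewrite expf_eq0 => /andP[_ /eqP a0]; rewrite -a0 as_ in s0.
by move=> b; rewrite mem_rem_uniq// inE => /andP[ba bs]; rewrite qb0// horner0 mulr0.
Qed.

Lemma coprimep_prod_XsubC_exp (F : fieldType) (s : seq F) (b : F) m :
  b \notin s -> coprimep (\prod_(a <- s) ('X - a%:P) ^+ m) (('X - b%:P) ^+ m).
Proof.
move=> bs; rewrite coprimep_expr// big_seq.
elim/big_rec: _ => [|a p as_ IH]; first exact: coprime1p.
rewrite coprimepMl IH andbT coprimep_expl// coprimep_XsubC root_XsubC.
by apply: contraNN bs => /eqP ->.
Qed.

(** The instance of the Chinese remainder theorem that gives the semisimple part
    of a matrix: a polynomial congruent to the constant [a] modulo
    [('X - a%:P) ^+ m] for every eigenvalue [a]. *)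
Lemma poly_crt (F : fieldType) (s : seq F) (m : nat) : uniq s ->
  exists S : {poly F}, {in s, forall a, ('X - a%:P) ^+ m %| S - a%:P}.
Proof.
elim: s => [|b s IHs]; first by exists 0.
move=> /= /andP[bs us]; have [S HS] := IHs us.
pose Q := \prod_(a <- s) ('X - a%:P) ^+ m.
have cop : coprimep Q (('X - b%:P) ^+ m) := coprimep_prod_XsubC_exp m bs.
have /Bezout_eq1_coprimepP[[u w] /= uw] := cop.
exists (S * (w * ('X - b%:P) ^+ m) + b%:P * (u * Q)) => a.
rewrite inE => /orP[/eqP ->|as_].
  have -> : S * (w * ('X - b%:P) ^+ m) + b%:P * (u * Q) - b%:P =
     (S - b%:P) * w * ('X - b%:P) ^+ m.
    by rewrite -[X in _ - X]mulr1 -uw; ring.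
  exact: dvdp_mull.
have -> : S * (w * ('X - b%:P) ^+ m) + b%:P * (u * Q) - a%:P =
     (S - a%:P) * (w * ('X - b%:P) ^+ m) + (b%:P - a%:P) * u * Q.
  by rewrite -[X in _ - X]mulr1 -uw; ring.
apply: dvdp_add; first by apply: dvdp_mulr; exact: HS.
by apply: dvdp_mull; rewrite /Q (big_rem a as_) /=; exact: dvdp_mulr.
Qed.

(** The semisimple part is [S = p(A)] with [p] from [poly_crt] at the eigenvalues
    of [A]: then [\prod_a (p - a)] and [('X - p) ^+ n.+1] are both divisible by the
    characteristic polynomial, so [S] is annihilated by a polynomial with simple
    roots and [A - S] is nilpotent. *)
Lemma jordan_chevalley (F : closedFieldType) n (A : 'M[F]_n.+1) : A \in unitmx ->
  exists S M : 'M[F]_n.+1,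
    [/\ S \in unitmx, mxpoly.diagonalizable S, S *m M = M *m S,
        exists m, M ^+ m = 0 & A = S *m (1%:M + M)].
Proof.
move=> Au; pose m := n.+1.
have [r char_r] := closed_field_poly_normal (char_poly A).
have lc1 : lead_coef (char_poly A) = 1 by apply/eqP/char_poly_monic.
rewrite lc1 scale1r in char_r.
have szr : size r = m.
  by have := size_char_poly A; rewrite char_r size_prod_XsubC => -[].
pose s := undup r.
have us : uniq s by exact: undup_uniq.
have [p Hp] := poly_crt m us.
(* As m is the degree, the characteristic polynomial divides the product
   of the ('X - a%:P) ^+ m over its distinct roots. *)
have charQ q : {in s, forall a, ('X - a%:P) ^+ m %| q} -> horner_mx A q = 0.
  move=> Hq; suff /dvdpP[c ->] : char_poly A %| q.
    by rewrite rmorphM/= Cayley_Hamilton mulr0.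
  have : \prod_(a <- s) ('X - a%:P) ^+ m %| q.
    elim: (s) us Hq => [_ _|b t IHt /= /andP[bt ut] Hq].
      by rewrite big_nil dvd1p.
    rewrite big_cons Gauss_dvdp; last first.
      by rewrite coprimep_sym coprimep_prod_XsubC_exp.
    rewrite Hq ?mem_head//= IHt// => a a_t; apply: Hq.
    by rewrite inE a_t orbT.
  apply: dvdp_trans; rewrite char_r -big_undup_iterop_count/=.
  rewrite -/s; elim/big_ind2: _ => // [x1 x2 y1 y2|a _]; first exact: dvdp_mul.
  rewrite Monoid.iteropE iter_mulr_1.
  apply: dvdp_exp2l; rewrite -szr; exact: count_size.
pose S := horner_mx A p; pose N := A - S.
have cAS : GRing.comm A S.
  by have := congr1 (horner_mx A) (mulrC 'X p); rewrite !rmorphM /= horner_mx_X.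
have Nm : N ^+ m = 0.
  have -> : N = horner_mx A ('X - p) by rewrite rmorphB /= horner_mx_X.
  rewrite -rmorphXn/=; apply: charQ => a /Hp Ha.
  apply: dvdp_exp2r.
  have -> : 'X - p = ('X - a%:P) - (p - a%:P) by ring.
  apply: dvdp_sub => //; apply: dvdp_trans Ha.
  by rewrite -{1}['X - _]expr1; exact: dvdp_exp2l.
(* A ^+ m = A ^+ m - N ^+ m is a multiple of A - N = S. *)
have Su : S \in unitmx.
  have cAN : GRing.comm A N by apply: commrB.
  have := subrXX_comm m cAN; rewrite Nm subr0 /N opprB addrC subrK => AmS.
  have : A ^+ m \is a GRing.unit by rewrite unitrX.
  rewrite AmS -[_ * _]/(_ *m _); rewrite -[_ \is a _]/(_ \in unitmx).
  by rewrite unitmx_mul => /andP[].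
have cSN : GRing.comm S N by apply: commrB => //; exact: commr_sym.
have cVN : GRing.comm S^-1 N by apply: commr_sym; apply: commrV; exact: commr_sym.
exists S, (S^-1 * N); split => //.
- apply/mxpoly.diagonalizableP; exists s => //.
  apply/mxminpoly_minP.
  have -> : horner_mx S (\prod_(x <- s) ('X - x%:P)) =
            horner_mx A (\prod_(x <- s) (p - x%:P)).
    rewrite !rmorph_prod; apply: eq_bigr => a _ /=.
    by rewrite !rmorphB /= !horner_mx_X !horner_mx_C.
  apply: charQ => a as_; rewrite (big_rem a as_)/=.
  exact/dvdp_mulr/Hp.
- rewrite -[_ *m _]/(S * (S^-1 * N)) -[RHS]/(S^-1 * N * S).
  by rewrite -mulrA -cSN mulrA mulrV// mul1r mulrA mulVr// mul1r.
- by exists m; rewrite exprMn_comm// Nm mulr0.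
rewrite -[1%:M]/1 -[_ *m _]/(S * (1 + S^-1 * N)).
by rewrite mulrDr mulr1 mulrA mulrV// mul1r /N addrC subrK.
Qed.

(** * Exponential polynomials *)

(** Sums of terms [a ^+ k * q.[t]] with [a != 0]: the discrete variable [k] and the
    continuous variable [t] are kept apart so that [k] can be frozen after the
    two have been identified. *)
Definition exp_poly (F : numFieldType) (g : nat -> F -> F) :=
  exists2 s : seq (F * {poly F}), all (fun x => x.1 != 0) s &
    forall k t, g k t = \sum_(x <- s) x.1 ^+ k * x.2.[t].

Section ExpPoly.
Variable F : numFieldType.
Implicit Types (g h : nat -> F -> F).

Lemma exp_poly_horner (q : {poly F}) : exp_poly (fun _ t => q.[t]).
Proof.
exists [:: (1, q)] => [|k t]; first by rewrite /= oner_eq0.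
by rewrite big_seq1 expr1n mul1r.
Qed.

Lemma exp_poly_expr (a : F) : a != 0 -> exp_poly (fun k _ => a ^+ k).
Proof.
move=> a0; exists [:: (a, 1)] => [|k t]; first by rewrite /= a0.
by rewrite big_seq1 hornerC mulr1.
Qed.

Lemma exp_polyD g h : exp_poly g -> exp_poly h ->
  exp_poly (fun k t => g k t + h k t).
Proof.
move=> [s s0 gE] [r r0 hE]; exists (s ++ r) => [|k t]; first by rewrite all_cat s0.
by rewrite big_cat /= gE hE.
Qed.

Lemma exp_polyM g h : exp_poly g -> exp_poly h ->
  exp_poly (fun k t => g k t * h k t).
Proof.
move=> [s s0 gE] [r r0 hE].
exists [seq (x.1 * y.1, x.2 * y.2) | x <- s, y <- r] => [|k t].
  apply/allP => _ /allpairsP[[x y] [/= xs yr ->]] /=.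
  by rewrite mulf_neq0// ?(allP s0 _ xs)// (allP r0 _ yr).
rewrite gE hE big_allpairs_dep mulr_suml; apply: eq_bigr => x _.
rewrite mulr_sumr; apply: eq_bigr => y _ /=.
by rewrite exprMn hornerM; ring.
Qed.

Lemma eq_exp_poly g h : (forall k t, g k t = h k t) -> exp_poly g -> exp_poly h.
Proof. by move=> gh [s s0 gE]; exists s => // k t; rewrite -gh gE. Qed.

Lemma exp_poly_cst c : exp_poly (fun _ _ => c : F).
Proof. by apply: eq_exp_poly (exp_poly_horner c%:P) => k t; rewrite hornerC. Qed.

Lemma exp_poly_big (op : F -> F -> F) (idx : F) I (r : seq I) (g : I -> nat -> F -> F) :
  (forall g1 g2, exp_poly g1 -> exp_poly g2 ->
    exp_poly (fun k t => op (g1 k t) (g2 k t))) ->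
  (forall i, exp_poly (g i)) ->
  exp_poly (fun k t => \big[op/idx]_(i <- r) g i k t).
Proof.
move=> opP gP; elim: r => [|i r IHr].
  by apply: eq_exp_poly (exp_poly_cst idx) => k t; rewrite big_nil.
by apply: eq_exp_poly (opP _ _ (gP i) IHr) => k t; rewrite big_cons.
Qed.

Lemma exp_poly_meval n (p : mpoly n F) (g : 'I_n -> nat -> F -> F) :
  (forall i, exp_poly (g i)) -> exp_poly (fun k t => meval (fun i => g i k t) p).
Proof.
move=> gP; apply: (@eq_exp_poly (fun k t => \sum_(m <- msupp p)
  mcoeff m p * \prod_i g i k t ^+ fun_of_multinom m i)) => [k t|].
  by rewrite mevalE.
apply: exp_poly_big => [g1 g2|m]; first exact: exp_polyD.
apply: exp_polyM; first exact: exp_poly_cst.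
apply: exp_poly_big => [g1 g2|i]; first exact: exp_polyM.
elim: (fun_of_multinom m i) => [|d IHd].
  by apply: eq_exp_poly (exp_poly_cst 1) => k t; rewrite expr0.
by apply: eq_exp_poly (exp_polyM (gP i) IHd) => k t; rewrite exprS.
Qed.

(** Grouping the terms by their base reduces this to [exp_poly_independent], which
    kills every coefficient. *)
Lemma exp_poly_diag0 g : exp_poly g -> (forall k, g k k%:R = 0) ->
  forall k t, g k t = 0.
Proof.
move=> [s s0 gE] g0.
pose q a := \sum_(x <- s | x.1 == a) x.2.
have gq k t : g k t = \sum_(a <- undup (map fst s)) a ^+ k * (q a).[t].
  rewrite gE big_seq.
  transitivity (\sum_(a <- undup (map fst s)) \sum_(x <- s | x.1 == a)
                  x.1 ^+ k * x.2.[t]); last first.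
    apply: eq_bigr => a _; rewrite /q horner_sum mulr_sumr.
    by apply: eq_bigr => x /eqP ->.
  rewrite (exchange_big_dep xpredT)//= -big_seq big_seq [RHS]big_seq.
  apply: eq_bigr => x xs.
  rewrite big_mkcond (bigD1_seq x.1) ?undup_uniq ?mem_undup ?map_f//= eqxx.
  by rewrite big1 ?addr0// => a; rewrite eq_sym => /negbTE ->.
move=> k t; rewrite gq big_seq big1// => a as_.
rewrite (@exp_poly_independent _ (undup (map fst s)) q) ?horner0 ?mulr0//.
- exact: undup_uniq.
- rewrite mem_undup; apply/negP => /mapP[x xs] x0.
  by have := allP s0 _ xs; rewrite -x0 eqxx.
- by move=> j; rewrite -gq g0.
Qed.
End ExpPoly.

(** * Complex powers of a unipotent matrix *)

Lemma poly_nat_ext (F : numFieldType) (p q : {poly F}) :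
  (forall k : nat, p.[k%:R] = q.[k%:R]) -> p = q.
Proof.
move=> pq; apply/eqP; rewrite -subr_eq0; apply/eqP/poly_nat_roots0 => k.
by rewrite hornerD hornerN pq subrr.
Qed.

Section BinomialPoly.
Variable F : numFieldType.

(** The binomial coefficient [t choose j] as a polynomial in [t]. *)
Definition binomial_poly j : {poly F} :=
  j`!%:R^-1 *: \prod_(i < j) ('X - i%:R%:P).

Lemma binomial_poly0 : binomial_poly 0 = 1.
Proof. by rewrite /binomial_poly big_ord0 fact0 invr1 scale1r. Qed.

Lemma binomial_poly1 : binomial_poly 1 = 'X.
Proof. by rewrite /binomial_poly big_ord1 factS fact0 invr1 scale1r subr0. Qed.

Lemma binomial_poly_nat j k : (binomial_poly j).[k%:R] = 'C(k, j)%:R.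
Proof.
have ffactE : \prod_(i < j) (k%:R - i%:R : F) = (k ^_ j)%:R.
  elim: j => [|j IHj]; first by rewrite big_ord0.
  rewrite big_ord_recr /= IHj ffactnSr natrM.
  have [jk|kj] := leqP j k; first by rewrite natrB.
  by rewrite ffact_small// !mul0r.
rewrite /binomial_poly hornerZ horner_prod.
under eq_bigr do rewrite hornerXsubC.
rewrite ffactE -bin_ffact natrM mulrC mulfK// pnatr_eq0 -lt0n.
Qed.

End BinomialPoly.

Section UnipotentPower.
Variables (F : numFieldType) (n m : nat) (M : 'M[F]_n.+1).
Hypothesis Mm : M ^+ m = 0.

(** The binomial series of [(1 + M) ^ t], which stops at [m] because
    [M ^+ m = 0]. *)
Definition unipotent_power t : 'M[F]_n.+1 :=
  \sum_(j < m) (binomial_poly F j).[t] *: M ^+ j.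

Definition unipotent_power_poly a b : {poly F} :=
  \sum_(j < m) (M ^+ j) a b *: binomial_poly F j.

Lemma unipotent_powerE t a b :
  unipotent_power t a b = (unipotent_power_poly a b).[t].
Proof.
rewrite summxE horner_sum; apply: eq_bigr => j _.
by rewrite mxE [RHS]hornerZ mulrC.
Qed.

Lemma unipotent_power_nat k : unipotent_power k%:R = (1 + M) ^+ k.
Proof.
rewrite addrC exprDn_comm; last exact: commr1.
pose f j := M ^+ j *+ 'C(k, j).
have -> : unipotent_power k%:R = \sum_(0 <= j < m) f j.
  rewrite big_mkord; apply: eq_bigr => j _.
  by rewrite binomial_poly_nat scaler_nat.
have -> : \sum_(i < k.+1) (M ^+ (k - i) * 1 ^+ i) *+ 'C(k, i) = \sum_(0 <= j < k.+1) f j.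
  rewrite big_mkord (reindex_inj rev_ord_inj) /=; apply: eq_bigr => i _.
  by rewrite expr1n mulr1 subSS subKn ?bin_sub// -ltnS.
have f0 j : (m <= j)%N || (k.+1 <= j)%N -> f j = 0.
  case/orP => h; last by rewrite /f bin_small.
  by rewrite /f -(subnK h) exprD Mm mulr0 mul0rn.
have big0 l : (l = m \/ l = k.+1) -> \sum_(0 <= j < l) f j = \sum_(0 <= j < m + k.+1) f j.
  move=> hl; have le : (l <= m + k.+1)%N by case: hl => ->; rewrite ?leq_addr ?leq_addl.
  rewrite (big_cat_nat _ le)//= -[LHS]addr0; congr (_ + _).
  rewrite big_nat big1// => j /andP[lj _].
  by apply: f0; case: hl lj => -> ->; rewrite ?orbT.
by rewrite (big0 m)/= ?(big0 k.+1); [|right|left].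
Qed.

(** Both sides are polynomial in [s] and in [t] and agree on natural numbers; one
    variable is extended at a time. *)
Lemma unipotent_powerD s t :
  unipotent_power (s + t) = unipotent_power s *m unipotent_power t.
Proof.
have natD k r : unipotent_power (k%:R + r) = unipotent_power k%:R *m unipotent_power r.
  apply/matrixP => a b; rewrite mxE !unipotent_powerE.
  have /(congr1 (fun p => p.[r])) :
    unipotent_power_poly a b \Po ('X + k%:R%:P) =
    \sum_c unipotent_power k%:R a c *: unipotent_power_poly c b.
    apply: poly_nat_ext => l.
    rewrite horner_comp hornerD hornerX hornerC -unipotent_powerE.
    rewrite [l%:R + _]addrC -natrD (unipotent_power_nat (k + l)) exprD.
    rewrite -!unipotent_power_nat horner_sum mxE.
    by apply: eq_bigr => c _; rewrite [RHS]hornerZ -unipotent_powerE.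
  rewrite horner_comp hornerD hornerX hornerC addrC => ->.
  by rewrite horner_sum; apply: eq_bigr => c _; rewrite hornerZ -unipotent_powerE.
apply/matrixP => a b; rewrite mxE !unipotent_powerE.
have /(congr1 (fun p => p.[s])) :
    unipotent_power_poly a b \Po ('X + t%:P) =
    \sum_c unipotent_power t c b *: unipotent_power_poly a c.
  apply: poly_nat_ext => k.
  rewrite horner_comp hornerD hornerX hornerC -unipotent_powerE natD.
  rewrite horner_sum mxE; apply: eq_bigr => c _.
  by rewrite hornerZ -unipotent_powerE mulrC.
rewrite horner_comp hornerD hornerX hornerC => ->.
rewrite horner_sum; apply: eq_bigr => c _.
by rewrite hornerZ -unipotent_powerE mulrC.
Qed.

Lemma unipotent_power0 : unipotent_power 0 = 1.
Proof. by rewrite -[0]/(0%:R) unipotent_power_nat expr0. Qed.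

Lemma unipotent_powerN t : unipotent_power t *m unipotent_power (- t) = 1%:M.
Proof. by rewrite -unipotent_powerD subrr unipotent_power0. Qed.

End UnipotentPower.

Section UnipotentPowerSub1.
Variables (F : numFieldType) (n m : nat) (M : 'M[F]_n.+1).
Hypothesis Mm : M ^+ m.+2 = 0.

Lemma unipotent_power_sub1 t : exists2 W, GRing.comm M W &
  unipotent_power m.+2 M t - 1 = M * (t%:M + M * W).
Proof.
exists (\sum_(j < m) (binomial_poly F j.+2).[t] *: M ^+ j).
  apply: commr_sum => j _; rewrite /GRing.comm -scalerAr -scalerAl.
  by rewrite -exprS exprSr.
rewrite /unipotent_power !big_ord_recl /= binomial_poly0 binomial_poly1.
rewrite hornerC hornerX scale1r expr0 addrC addKr.
rewrite mulrDr; congr (_ + _).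
  by rewrite -[RHS]/(_ *m _) mul_mx_scalar expr1.
rewrite !mulr_sumr; apply: eq_bigr => j _.
by rewrite -!scalerAr -!exprS.
Qed.

Lemma unipotent_power_nilp t : (unipotent_power m.+2 M t - 1) ^+ m.+2 = 0.
Proof.
have [W cMW ->] := unipotent_power_sub1 t.
rewrite exprMn_comm ?Mm ?mul0r//; apply: commrD.
  by rewrite /GRing.comm -[LHS]/(_ *m _) -[RHS]/(_ *m _) scalar_mxC.
by apply: commrM.
Qed.

(** The parameter [t] of a point [B] of the one-parameter group is an affine
    function of [B]: it is the factor in front of the last nonzero power of
    [M]. *)
Lemma unipotent_power_coord t :
  (unipotent_power m.+2 M t - 1) * M ^+ m = t *: M ^+ m.+1.
Proof.
have [W cMW ->] := unipotent_power_sub1 t.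
rewrite mulrDr mulrDl mulrA -[M * t%:M]/(_ *m _) mul_mx_scalar -scalerAl -exprS.
rewrite -!mulrA; have /commr_sym -> : GRing.comm (M ^+ m) W.
  by apply/commr_sym/commrX/commr_sym.
by rewrite (mulrA M (M ^+ m)) -exprS (mulrA M) -exprS Mm mul0r addr0.
Qed.

End UnipotentPowerSub1.

(** * Elements of a torus are diagonalizable *)

Lemma diag_similar_expr (F : fieldType) n (P S : 'M[F]_n.+1) (d : 'rV_n.+1) k :
  P \in unitmx -> S = invmx P *m diag_mx d *m P ->
  S ^+ k = invmx P *m diag_mx (\row_i d 0 i ^+ k) *m P.
Proof.
move=> Pu SE; elim: k => [|k IHk].
  have -> : \row_i d 0 i ^+ 0 = const_mx 1 by apply/rowP => i; rewrite !mxE.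
  by rewrite diag_const_mx mulmx1 mulVmx.
rewrite exprS IHk -[LHS]/(_ *m _) {1}SE !mulmxA mulmxK//; congr (_ *m _).
rewrite -!mulmxA mulmx_diag; congr (_ *m diag_mx _).
by apply/rowP => i; rewrite !mxE exprS.
Qed.

Lemma diagonalizable_similarP (F : fieldType) n (S : 'M[F]_n) :
  mxpoly.diagonalizable S ->
  exists2 P, P \in unitmx & exists d, S = invmx P *m diag_mx d *m P.
Proof.
move=> [P Pu /(mxpoly.diagonalizable_forLR Pu)[d Sd]]; exists P => //; exists d.
by rewrite Sd mxpoly.conjumx ?unitmx_inv// invmxK.
Qed.

Section RegularFunction.
Variables (R : realType) (n : nat).
Local Notation C := R[i].
Implicit Types (f g : 'M[C]_n -> C).

(** Regular functions on the affine space of matrices, kept existential so that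
    closure properties replace explicit polynomials. *)
Definition regular_function f := exists p : mpoly (n * n) C,
  forall A, f A = meval (fun k => mxvec A 0 k) p.

Lemma regular_function_coord a b : regular_function (fun A => A a b).
Proof.
by exists (mpolyX _ (mnm1 (mxvec_index a b))) => A; rewrite mevalXU mxvecE.
Qed.

Lemma regular_function_cst c : regular_function (fun=> c).
Proof. by exists (mpolyC _ c) => A; rewrite mevalC. Qed.

Lemma regular_functionD f g :
  regular_function f -> regular_function g -> regular_function (fun A => f A + g A).
Proof. by move=> [p fE] [q gE]; exists (p + q) => A; rewrite mevalD fE gE. Qed.

Lemma regular_functionM f g :
  regular_function f -> regular_function g -> regular_function (fun A => f A * g A).
Proof. by move=> [p fE] [q gE]; exists (p * q) => A; rewrite mevalM fE gE. Qed.

Lemma eq_regular_function f g : (forall A, f A = g A) -> regular_function f -> regular_function g.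
Proof. by move=> fg [p fE]; exists p => A; rewrite -fg. Qed.

Lemma regular_function_horner (q : {poly C}) f :
  regular_function f -> regular_function (fun A => q.[f A]).
Proof.
move=> rf; elim/poly_ind: q => [|q c IHq].
  by apply: eq_regular_function (regular_function_cst 0) => A; rewrite horner0.
apply: eq_regular_function (regular_functionD (regular_functionM IHq rf) (regular_function_cst c)).
move=> A.
by rewrite hornerMXaddC.
Qed.

Lemma regular_function_sum I (r : seq I) (f : I -> 'M[C]_n -> C) :
  (forall i, regular_function (f i)) -> regular_function (fun A => \sum_(i <- r) f i A).
Proof.
move=> rf; elim: r => [|i r IHr].
  by apply: eq_regular_function (regular_function_cst 0) => A; rewrite big_nil.
by apply: eq_regular_function (regular_functionD (rf i) IHr) => A; rewrite big_cons.
Qed.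

Lemma zariski_closed_eqs I (f : I -> 'M[C]_n -> C) : (forall i, regular_function (f i)) ->
  zariski_closed [set A | forall i, f i A = 0].
Proof.
move=> rf; exists [set p | exists i, forall A, f i A = meval (fun k => mxvec A 0 k) p].
apply/seteqP; split=> A /= fA.
  by move=> p [i fE]; rewrite -fE.
by move=> i; have [p fE] := rf i; rewrite fE; apply: fA; exists i.
Qed.

(** Along a polynomial curve, a polynomial function of several variables is a
    polynomial in the parameter. *)
Lemma horner_mmap N (p : mpoly N C) (v : 'I_N -> {poly C}) t :
  (mmap (@polyC C) v p).[t] = meval (fun i => (v i).[t]) p.
Proof.
rewrite mevalE /mmap horner_sum; apply: eq_bigr => m _.
rewrite hornerM hornerC /mmap1 horner_prod; congr (_ * _).
by apply: eq_bigr => i _; rewrite horner_exp.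
Qed.

End RegularFunction.

Section OneParameter.
Variables (R : realType) (n : nat).
Local Notation C := R[i].

(** Integral powers of [S *m (1%:M + M)] lie in [T].  An equation of [T] evaluated
    at [S ^+ k *m unipotent_power m M t] is an exponential polynomial in [(k, t)],
    and it vanishes for [t = k]; so it vanishes at [k = 0] for every [t]. *)
Lemma algebraic_unipotent_power (T : set 'M[C]_n.+1) (S M : 'M[C]_n.+1) m t :
  algebraic_subgroup T -> T (S *m (1%:M + M)) -> S \in unitmx ->
  mxpoly.diagonalizable S -> S *m M = M *m S -> M ^+ m = 0 ->
  T (unipotent_power m M t).
Proof.
move=> [[_ T1 TM _] [I TE]] TA Su /diagonalizable_similarP[P Pu [d SE]] cSM Mm.
have TAk k : T (S ^+ k *m (1 + M) ^+ k).
  have -> : S ^+ k *m (1 + M) ^+ k = (S * (1 + M)) ^+ k.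
    by rewrite exprMn_comm//; apply: commrD; [exact: commr1|exact: cSM].
  by elim: k => // k IHk; rewrite exprS; exact: TM.
have d0 e : d 0 e != 0.
  move: Su; rewrite SE !unitmx_mul => /andP[/andP[_]].
  rewrite unitmxE det_diag unitfE => /prodf_neq0 d0 _.
  exact: d0.
suff : T (S ^+ 0 *m unipotent_power m M t) by rewrite expr0 mul1mx.
move: TAk; rewrite TE /= => TAk p Ip.
apply: (@exp_poly_diag0 _ (fun k t =>
  meval (fun i => mxvec (S ^+ k *m unipotent_power m M t) 0 i) p)).
  apply: exp_poly_meval => i; case/mxvec_indexP: i => a b.
  apply: (@eq_exp_poly _ (fun k t => \sum_c \sum_e
    (invmx P a e * d 0 e ^+ k * P e c * (unipotent_power_poly m M c b).[t]))).
    move=> k u; rewrite mxvecE mxE; apply: eq_bigr => c _.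
    rewrite (diag_similar_expr _ Pu SE) mxE mulr_suml; apply: eq_bigr => e _.
    by rewrite mul_mx_diag !mxE unipotent_powerE.
  apply: exp_poly_big => [|c]; first exact: exp_polyD.
  apply: exp_poly_big => [|e]; first exact: exp_polyD.
  do 2?apply: exp_polyM; try exact: exp_poly_cst; last exact: exp_poly_horner.
  by apply: exp_polyM; [exact: exp_poly_cst|exact: exp_poly_expr].
by move=> k; rewrite unipotent_power_nat//; exact: TAk.
Qed.

(** By [unipotent_power_coord] there is an affine function [l] with
    [l (unipotent_power m.+2 M t) = t], so the group is the set of the matrices [B]
    with [B = unipotent_power m.+2 M (l B)], which are polynomial equations. *)
Lemma unipotent_power_algebraic (M : 'M[C]_n.+1) m :
  M ^+ m.+2 = 0 -> M ^+ m.+1 != 0 -> range (unipotent_power m.+2 M) `<=` SL R n.+1 ->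
  algebraic_subgroup (range (unipotent_power m.+2 M)).
Proof.
move=> Mm /matrix0Pn[a [b Mab]] Usl; split.
  split => //.
  - by exists 0 => //; rewrite (unipotent_power0 Mm).
  - by move=> _ _ [s _ <-] [t _ <-]; exists (s + t) => //; rewrite (unipotent_powerD Mm).
  - move=> _ [t _ <-]; exists (- t) => //.
    have Ut := unipotent_powerN Mm t.
    have [Uu _] := mulmx1_unit Ut.
    by rewrite -[RHS]mulmx1 -Ut (mulKmx Uu).
pose l (A : 'M[C]_n.+1) := ((A - 1) * M ^+ m) a b * ((M ^+ m.+1) a b)^-1.
have lU t : l (unipotent_power m.+2 M t) = t.
  by rewrite /l (unipotent_power_coord Mm) mxE mulfK.
have rl : regular_function l.
  apply: regular_functionM; last exact: regular_function_cst.
  apply: (@eq_regular_function _ _ (fun A => \sum_c (A a c + (- 1%:M) a c) * (M ^+ m) c b)).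
    by move=> A; rewrite mxE; apply: eq_bigr => c _; rewrite !mxE.
  apply: regular_function_sum => c; apply: regular_functionM; last exact: regular_function_cst.
  by apply: regular_functionD; [exact: regular_function_coord|exact: regular_function_cst].
have -> : range (unipotent_power m.+2 M) = [set A : 'M[C]_n.+1 | forall i : 'I_n.+1 * 'I_n.+1,
    (A i.1 i.2 + (- unipotent_power_poly m.+2 M i.1 i.2).[l A] = 0)].
  apply/seteqP; split => [_ [t _ <-] [i j] /=|A /= AE].
    by rewrite lU hornerN unipotent_powerE subrr.
  exists (l A) => //; apply/matrixP => i j; apply/esym/eqP.
  by rewrite unipotent_powerE -subr_eq0 -hornerN (AE (i, j)).
apply: zariski_closed_eqs => i; apply: regular_functionD; first exact: regular_function_coord.
exact: regular_function_horner.
Qed.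

(** The image of the affine line is irreducible: if it is contained in neither
    of two closed sets, equations [p1], [p2] of these sets restrict to nonzero
    polynomials in the parameter, whose product cannot vanish identically. *)
Lemma unipotent_power_connected (M : 'M[C]_n.+1) m :
  zariski_connected (range (unipotent_power m M)).
Proof.
move=> Z1 Z2 [S1 Z1E] [S2 Z2E] UZ _.
pose P p : {poly C} :=
  mmap (@polyC C) (fun k => mxvec (\matrix_(a, b) unipotent_power_poly m M a b) 0 k) p.
have PE p t : (P p).[t] = meval (fun k => mxvec (unipotent_power m M t) 0 k) p.
  rewrite horner_mmap; apply: meval_eq => k; case/mxvec_indexP: k => a b.
  by rewrite !mxvecE mxE unipotent_powerE.
have sep Z S : Z = [set A | forall p, S p -> meval (fun k => mxvec A 0 k) p = 0] ->
    ~ (range (unipotent_power m M) `<=` Z) -> exists2 p, S p & P p != 0.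
  move=> ZE nUZ; apply: contrapT => nP; apply: nUZ => _ [t _ <-]; rewrite ZE => p Sp.
  rewrite -PE; have [->|P0] := eqVneq (P p) 0; first by rewrite horner0.
  by case: nP; exists p.
apply: contrapT => /not_orP[/(sep _ _ Z1E)[p1 S1p P1] /(sep _ _ Z2E)[p2 S2p P2]].
have /eqP := mulf_neq0 P1 P2; apply; apply: poly_nat_roots0 => k.
have /UZ : range (unipotent_power m M) (unipotent_power m M k%:R) by exists k%:R.
rewrite hornerM !PE Z1E Z2E => -[/(_ _ S1p) ->|/(_ _ S2p) ->].
  by rewrite mul0r.
by rewrite mulr0.
Qed.

(** If the unipotent part [1 + M] of [A] were not trivial, its complex powers would
    form a nontrivial subgroup of [T] of the kind excluded by reductivity. *)
Lemma torus_diagonalizable (T : set 'M[C]_n.+1) (A : 'M[C]_n.+1) :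
  torus T -> T A -> mxpoly.diagonalizable A.
Proof.
move=> [Talg Tcomm Tred] TA.
have [[Tsl _ _ _] _] := Talg.
have Au : A \in unitmx by rewrite unitmxE (Tsl _ TA) unitr1.
have [S [M [Su Sd cSM [m0 Mm0] AE]]] := jordan_chevalley Au.
suff M0 : M = 0 by rewrite AE M0 addr0 mulmx1.
have exm : exists m, M ^+ m == 0 by exists m0; apply/eqP.
have [[|[|m]] /eqP Mm mmin] := ex_minnP exm.
- by move/eqP: Mm; rewrite expr0 oner_eq0.
- by rewrite expr1 in Mm.
have M1 : M ^+ m.+1 != 0 by apply/negP => /mmin; rewrite ltnn.
have UT : range (unipotent_power m.+2 M) `<=` T.
  by move=> _ [t _ <-]; apply: (@algebraic_unipotent_power T S) => //; rewrite -AE.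
have U1 : range (unipotent_power m.+2 M) = [set 1%:M].
  apply: Tred.
  - by apply: unipotent_power_algebraic => // B /UT; exact: Tsl.
  - split=> // B B' TB /[dup] UB' /UT TB'.
    rewrite (Tcomm B B')// mulmxK// unitmxE (Tsl _ TB); exact: unitr1.
  - exact: unipotent_power_connected.
  - by move=> _ [t _ <-]; exists m.+2; exact: unipotent_power_nilp.
have : [set 1%:M] (unipotent_power m.+2 M 1%:R) by rewrite -U1; exists 1%:R.
rewrite (unipotent_power_nat Mm 1) expr1 /= => /eqP.
by rewrite -[1%:M]/(1 : 'M[C]_n.+1) -subr_eq0 addrC addKr => /eqP.
Qed.

End OneParameter.

(** * Linear orbit maps of a torus *)

(** Reduces the simultaneous diagonalization of the infinite set [T] to that of a
    finite family: one whose span has maximal dimension already spans [T]. *)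
Lemma finite_spanning_subset (F : fieldType) (V : vectType F) (T : set V) :
  exists2 s : seq V, {in s, forall x, T x} & forall x, T x -> (x \in span s).
Proof.
pose dims (d : nat) := `[< exists2 s : seq V, {in s, forall x, T x} & \dim (span s) = d >].
have ex_dim : exists d, dims d by exists 0%N; apply/asboolP; exists [::]; rewrite ?span_nil ?dimv0.
have dim_le d : dims d -> (d <= dim V)%N.
  by move=> /asboolP[s _ <-]; rewrite -dimvf; apply: dimvS; exact: subvf.
have [d /asboolP[s sT sd] dmax] := ex_maxnP ex_dim dim_le.
exists s => // x Tx.
have sub : (span s <= span (x :: s))%VS by rewrite span_cons addvSr.
have : (\dim (span (x :: s)) <= \dim (span s))%N.
  rewrite sd; apply: dmax; apply/asboolP; exists (x :: s) => // y.
  by rewrite inE => /predU1P[->//|/sT].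
move=> le; have /eqP -> : span s == span (x :: s) by rewrite eqEdim sub.
by apply: memv_span; exact: mem_head.
Qed.

Section TorusOrbit.
Variables (R : realType) (n : nat).
Local Notation C := R[i].

Lemma torus_codiagonalizable (T : set 'M[C]_n.+1) : torus T ->
  exists2 P, P \in unitmx & forall A, T A -> exists d, A = invmx P *m diag_mx d *m P.
Proof.
move=> torT; have [_ Tcomm _] := torT.
have [s sT spanT] := finite_spanning_subset T.
have /mxpoly.codiagonalizableP[P Pu /allP /= sdiag] :
   {in s &, forall A B, comm_mx A B} /\ {in s, forall A, mxpoly.diagonalizable A}.
  by split=> [A B /sT TA /sT TB|A /sT]; [exact: Tcomm|exact: torus_diagonalizable].
exists P => // A TA.
suff dA : diagonalizable_for P A.
  have [d ->] := mxpoly.diagonalizable_forLR Pu dA; exists d.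
  by rewrite mxpoly.conjumx ?unitmx_inv// invmxK.
apply/diagonalizable_forP => // i j ij.
have /coord_span -> : A \in span (in_tuple s) by exact: spanT.
rewrite mulmx_sumr mulmx_suml summxE big1// => k _.
rewrite -scalemxAr -scalemxAl mxE.
have /sdiag/diagonalizable_forP -> // : (in_tuple s)`_k \in s by exact: mem_nth.
by rewrite mulr0.
Qed.

(** In a basis of common eigenvectors, with [v] their sum, the coordinates of
    [A *m v] are the eigenvalues of [A]. *)
Lemma torus_orbit (T : set 'M[C]_n.+1) : torus T ->
  exists P (v : 'cV[C]_n.+1), [/\ P \in unitmx, v != 0 &
    forall A, T A -> A = invmx P *m diag_mx (P *m (A *m v))^T *m P].
Proof.
move=> /torus_codiagonalizable[P Pu Tdiag].
exists P, (invmx P *m const_mx 1); split => //.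
  apply/negP => /eqP /(congr1 (mulmx P)); rewrite mulKVmx// mulmx0.
  by move/matrixP/(_ ord0 ord0); rewrite !mxE => /eqP; rewrite oner_eq0.
move=> A /Tdiag[d Ad]; suff -> : P *m (A *m (invmx P *m const_mx 1)) = d^T by rewrite trmxK.
rewrite Ad -!mulmxA (mulKVmx Pu) (mulKVmx Pu).
by apply/colP => i; rewrite mul_diag_mx !mxE mulr1.
Qed.
End TorusOrbit.

(** * Quadratic estimates and complex limits *)

Lemma linear_le_continuous (K : numFieldType) (V W : normedModType K)
    (l : {linear V -> W}) (a : K) :
  0 <= a -> (forall d, `|l d| <= a * `|d|) -> continuous l.
Proof.
move=> a0 la; apply: bounded_linear_continuous; apply/linear_boundedP; exists a.
split=> [|r ar x]; first by rewrite ger0_real.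
by apply: le_trans (la x) _; rewrite ler_wpM2r// ltW.
Qed.

Lemma quadratic_differentiable (K : numFieldType) (V W : normedModType K)
    (f : V -> W) (z : V) (L : V -> W) (a : K) :
  linear L -> 0 <= a -> (forall d, `|L d| <= a * `|d|) ->
  (forall y, `|y - z| <= 1 -> `|f y - f z - L (y - z)| <= a * `|y - z| ^+ 2) ->
  differentiable f z.
Proof.
move=> linL a0 Lb fL.
pose df : {linear V -> W} := HB.pack L (GRing.isLinear.Build K V W *:%R L linL).
have cdf : continuous df := linear_le_continuous (l := df) a0 Lb.
have fE : f \o shift z = cst (f z) + df +o_ (0 : V) id.
  apply/eqaddoP => _/posnumP[e]; near=> h.
  have -> : (f \o shift z - (cst (f z) + df)) h = f (h + z) - f z - L (h + z - z).
    by rewrite addrK [LHS]/= opprD addrA.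
  apply: le_trans (fL _ _) _; rewrite addrK.
    by near: h; exact: nbhs0_le.
  rewrite expr2 mulrA ler_wpM2r//.
  have : `|h| <= e%:num / (a + 1) by near: h; apply: nbhs0_le; rewrite divr_gt0// ltr_wpDl.
  rewrite ler_pdivlMr ?ltr_wpDl// mulrC; apply: le_trans.
  by rewrite ler_wpM2r// lerDl.
by apply/diff_locallyP; rewrite (diff_unique cdf fE).
Unshelve. all: by end_near.
Qed.

Section GeometricCauchy.
Variable R : realType.

Lemma norm_real_complex (x : R) : `|x%:C| = `|x|%:C.
Proof. by rewrite normc_def /= expr0n addr0 sqrtr_sqr. Qed.

Lemma norm_ge_Im (z : R[i]) : `|complex.Im z|%:C <= `|z|.
Proof.
have := normc_ge_Re (z * 'i%C); rewrite ReiNIm normrN normrM.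
by rewrite complexiE normCi mulr1.
Qed.

Lemma norm_le_ReIm (x y : R) : `|x +i* y : R[i]| <= (`|x| + `|y|)%:C.
Proof.
rewrite (_ : x +i* y = x%:C + y%:C * 'i%C); last by simpc.
apply: le_trans (ler_normD _ _) _.
by rewrite normrM complexiE normCi mulr1 !norm_real_complex rmorphD.
Qed.

(** The sequences [u k - 2 * 2^-1 ^+ k] and [u k + 2 * 2^-1 ^+ k] are nondecreasing and
    nonincreasing, so the supremum of the former lies between them. *)
Lemma geometric_cauchy_real (u : nat -> R) K :
  (forall k, (K <= k)%N -> `|u k.+1 - u k| <= 2^-1 ^+ k) ->
  exists l, forall k, (K <= k)%N -> `|u k - l| <= 2 * 2^-1 ^+ k.
Proof.
move=> uK; have half_ge0 : 0 <= 2^-1 :> R by rewrite invr_ge0.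
pose b k := u (K + k)%N + 2 * 2^-1 ^+ (K + k).
pose c k := u (K + k)%N - 2 * 2^-1 ^+ (K + k).
have stepb k : b k.+1 <= b k.
  have := uK (K + k)%N (leq_addr _ _); rewrite /b addnS exprS ler_norml; lra.
have stepc k : c k <= c k.+1.
  have := uK (K + k)%N (leq_addr _ _); rewrite /c addnS exprS ler_norml; lra.
have cb j k : c j <= b k.
  have mc i l : c i <= c (i + l)%N.
    by elim: l => [|l IHl]; rewrite ?addn0// addnS (le_trans IHl).
  have mb i l : b (i + l)%N <= b i.
    by elim: l => [|l IHl]; rewrite ?addn0// addnS (le_trans _ IHl).
  apply: le_trans (mc j k) _; rewrite addnC; apply: le_trans (mb k j).
  by rewrite /b /c; have : 0 <= (2^-1 : R) ^+ (K + (k + j)) := exprn_ge0 _ half_ge0; lra.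
have cbd : has_sup (range c).
  by split; [exists (c 0%N), 0%N|exists (b 0%N) => _ [j _ <-]].
exists (sup (range c)) => k Kk.
have := ub_le_sup (proj2 cbd) (ex_intro2 _ _ (k - K)%N I erefl).
have : sup (range c) <= b (k - K)%N by apply: ge_sup => [|_ [j _ <-]//]; exact: (proj1 cbd).
by rewrite /b /c subnKC// ler_norml; lra.
Qed.

Lemma geometric_cauchy (u : nat -> R[i]) K :
  (forall k, (K <= k)%N -> `|u k.+1 - u k| <= 2^-1 ^+ k) ->
  exists l, forall k, (K <= k)%N -> `|u k - l| <= 4 * 2^-1 ^+ k.
Proof.
move=> uK.
have half k : (2^-1 : R[i]) ^+ k = ((2^-1 : R) ^+ k)%:C.
  by rewrite rmorphXn/= fmorphV/= rmorph_nat.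
have [lr Hr] : exists l, forall k, (K <= k)%N -> `|complex.Re (u k) - l| <= 2 * 2^-1 ^+ k.
  apply: geometric_cauchy_real => k /uK; rewrite half => h.
  by have := le_trans (normc_ge_Re _) h; rewrite lecR raddfB.
have [li Hi] : exists l, forall k, (K <= k)%N -> `|complex.Im (u k) - l| <= 2 * 2^-1 ^+ k.
  apply: geometric_cauchy_real => k /uK; rewrite half => h.
  by have := le_trans (norm_ge_Im _) h; rewrite lecR raddfB.
exists (lr +i* li) => k Kk.
have -> : u k - (lr +i* li) = (complex.Re (u k) - lr) +i* (complex.Im (u k) - li).
  by case: (u k).
apply: le_trans (norm_le_ReIm _ _) _; rewrite half.
have -> : 4 * (2^-1 ^+ k)%:C = (4 * 2^-1 ^+ k)%:C :> R[i] by rewrite rmorphM/= rmorph_nat.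
by rewrite lecR; have := Hr k Kk; have := Hi k Kk; lra.
Qed.
End GeometricCauchy.

(** * Second-order estimates on balls *)

Section JetBound.
Variables (K : numFieldType) (V : normedModType K).
Implicit Types (f g : V -> K) (L G : V -> V -> K).

(** [L z] is the derivative of [f] at [z].  The common bound is [a / 3] and not [a]
    because the estimates for a product then hold with the product of the bounds:
    the product rule and the second-order remainder of a product have at most three
    terms. *)
Definition jet_bound (r a : K) f L := forall y z, `|y| <= r -> `|z| <= r ->
  [/\ `|f z| <= a / 3, forall d, `|L z d| <= a / 3 * `|d|,
      `|f y - f z| <= a / 3 * `|y - z| &
      `|f y - f z - L z (y - z)| <= a / 3 * `|y - z| ^+ 2].

Lemma jet_bound_le r r' a a' f L : r <= r' -> a' <= a ->
  jet_bound r' a' f L -> jet_bound r a f L.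
Proof.
move=> rr aa fL y z yr zr; have [] := fL y z (le_trans yr rr) (le_trans zr rr).
have aa3 : a' / 3 <= a / 3 by rewrite ler_wpM2r// invr_ge0.
move=> h1 h2 h3 h4; split => [|d||]; first exact: le_trans h1 _.
- by apply: le_trans (h2 d) _; rewrite ler_wpM2r.
- by apply: le_trans h3 _; rewrite ler_wpM2r.
- by apply: le_trans h4 _; rewrite ler_wpM2r// exprn_ge0.
Qed.

Lemma jet_bound_cst r c : jet_bound r (3 * `|c|) (fun=> c) (fun _ _ => 0).
Proof.
have c0 : 0 <= 3 * `|c| / 3 by rewrite divr_ge0// mulr_ge0.
move=> y z _ _; split=> [|d||].
- by rewrite mulrAC divff// mul1r.
- by rewrite normr0 mulr_ge0.
- by rewrite subrr normr0 mulr_ge0.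
- by rewrite !subrr normr0 mulr_ge0// exprn_ge0.
Qed.

Lemma jet_bound_linear r s (l : {linear V -> K}) : 0 <= s ->
  (forall d, `|l d| <= s * `|d|) ->
  jet_bound r (3 * (s * (r + 1))) l (fun _ => l).
Proof.
move=> s0 ls y z yr zr; have r0 : 0 <= r by exact: le_trans yr.
have -> : 3 * (s * (r + 1)) / 3 = s * (r + 1) by rewrite mulrAC divff// mul1r.
have ls1 d : `|l d| <= s * (r + 1) * `|d|.
  by apply: le_trans (ls d) _; rewrite ler_wpM2r// ler_peMr// lerDr.
split=> //.
- by apply: le_trans (ls z) _; rewrite ler_wpM2l// (le_trans zr)// lerDl.
- by rewrite -linearB.
- rewrite -linearB subrr normr0 mulr_ge0 ?exprn_ge0//.
  by rewrite mulr_ge0// addr_ge0.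
Qed.

Lemma jet_boundD r a b f L g G : jet_bound r a f L -> jet_bound r b g G ->
  jet_bound r (a + b) (fun x => f x + g x) (fun z d => L z d + G z d).
Proof.
move=> fL gG y z yr zr; have [f1 f2 f3 f4] := fL y z yr zr.
have [g1 g2 g3 g4] := gG y z yr zr.
rewrite !mulrDl; split=> [|d||].
- by apply: le_trans (ler_normD _ _) _; exact: lerD.
- by rewrite !mulrDl; apply: le_trans (ler_normD _ _) _; exact: lerD.
- rewrite opprD addrACA; apply: le_trans (ler_normD _ _) _; exact: lerD.
- have -> : f y + g y - (f z + g z) - (L z (y - z) + G z (y - z)) =
    (f y - f z - L z (y - z)) + (g y - g z - G z (y - z)) by ring.
  by apply: le_trans (ler_normD _ _) _; exact: lerD.
Qed.

Lemma jet_boundM r a b f L g G : jet_bound r a f L -> jet_bound r b g G ->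
  jet_bound r (a * b) (fun x => f x * g x) (fun z d => f z * G z d + L z d * g z).
Proof.
move=> fL gG y z yr zr; have [f1 f2 f3 f4] := fL y z yr zr.
have [fy _ _ _] := fL z y zr yr; have [g1 g2 g3 g4] := gG y z yr zr.
set A := a / 3 in f1 f2 f3 f4 fy; set B := b / 3 in g1 g2 g3 g4.
have A0 : 0 <= A by exact: le_trans f1.
have B0 : 0 <= B by exact: le_trans g1.
have -> : a * b / 3 = A * B + A * B + A * B.
  by rewrite /A /B; field.
have AB0 : 0 <= A * B by rewrite mulr_ge0.
have AB2 : A * B <= A * B + A * B by rewrite lerDl.
have AB3 : A * B + A * B <= A * B + A * B + A * B by rewrite lerDl.
split=> [|d||].
- by rewrite normrM (le_trans _ (le_trans AB2 AB3))// ler_pM.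
- apply: (@le_trans _ _ ((A * B + A * B) * `|d|)); last by rewrite ler_wpM2r.
  rewrite [leRHS]mulrDl; apply: le_trans (ler_normD _ _) _; apply: lerD.
    by rewrite normrM -mulrA ler_pM.
  by rewrite normrM mulrAC ler_pM.
- apply: (@le_trans _ _ ((A * B + A * B) * `|y - z|)); last by rewrite ler_wpM2r.
  have -> : f y * g y - f z * g z = f y * (g y - g z) + (f y - f z) * g z by ring.
  rewrite [leRHS]mulrDl; apply: le_trans (ler_normD _ _) _; apply: lerD.
    by rewrite normrM -mulrA ler_pM.
  by rewrite normrM mulrAC ler_pM.
have -> : f y * g y - f z * g z - (f z * G z (y - z) + L z (y - z) * g z) =
   f y * (g y - g z - G z (y - z)) + (f y - f z) * G z (y - z) +
   (f y - f z - L z (y - z)) * g z by ring.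
rewrite [leRHS]mulrDl [X in _ <= X + _]mulrDl.
apply: le_trans (ler_normD _ _) _; apply: lerD; last first.
  by rewrite normrM mulrAC ler_pM.
apply: le_trans (ler_normD _ _) _; apply: lerD.
  by rewrite normrM -mulrA ler_pM.
rewrite normrM expr2 mulrACA; exact: ler_pM.
Qed.

(** The counterpart of replacing, in a polynomial, the coefficients by their norms
    and the coordinates by a radius.  Keeping the bound as a function of [r] allows
    the exponent of a power to be chosen from the bound on one ball while estimates
    remain on all others. *)
Definition majorized (N : K -> K) f := exists2 L, forall z, linear (L z) &
  forall r, 0 <= r -> 0 <= N r /\ jet_bound r (N r) f L.

Lemma majorized_cst c : majorized (fun=> 3 * `|c|) (fun=> c).
Proof.
exists (fun _ _ => 0) => [z b x y|r _]; first by rewrite scaler0 addr0.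
by split; [rewrite mulr_ge0|exact: jet_bound_cst].
Qed.

Lemma majorized_linear s (l : {linear V -> K}) : 0 <= s ->
  (forall d, `|l d| <= s * `|d|) -> majorized (fun r => 3 * (s * (r + 1))) l.
Proof.
move=> s0 ls; exists (fun _ => l) => [z b x y|r r0]; first exact: linearP.
by split; [rewrite !mulr_ge0// addr_ge0|exact: jet_bound_linear].
Qed.

Lemma majorizedD N M f g : majorized N f -> majorized M g ->
  majorized (fun r => N r + M r) (fun x => f x + g x).
Proof.
move=> [L linL fL] [G linG gG]; exists (fun z d => L z d + G z d).
  by move=> z b x y; rewrite linL linG scalerDr addrACA.
move=> r r0; have [N0 fr] := fL r r0; have [M0 gr] := gG r r0.
by split; [exact: addr_ge0|exact: jet_boundD].
Qed.

Lemma majorizedM N M f g : majorized N f -> majorized M g ->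
  majorized (fun r => N r * M r) (fun x => f x * g x).
Proof.
move=> [L linL fL] [G linG gG]; exists (fun z d => f z * G z d + L z d * g z).
  move=> z b x y; rewrite linL linG mulrDr mulrDl scalerDr addrACA.
  by rewrite scalerAr scalerAl.
move=> r r0; have [N0 fr] := fL r r0; have [M0 gr] := gG r r0.
by split; [exact: mulr_ge0|exact: jet_boundM].
Qed.

(** The factor [3] is the bound of the empty product. *)
Lemma majorizedX N f m : majorized N f ->
  majorized (fun r => 3 * N r ^+ m) (fun x => f x ^+ m).
Proof.
move=> fN; elim: m => [|m IHm].
  have [L linL fL] := majorized_cst 1; exists L => // r /fL.
  by rewrite normr1 expr0.
have [L linL fL] := majorizedM fN IHm; exists L => // r /fL.
rewrite mulrCA -exprS.
by under [X in jet_bound _ _ X]eq_fun do rewrite -exprS.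
Qed.

End JetBound.

(** * Interpolating polynomials *)

Section MatrixNorm.
Variables (K : numFieldType) (m n : nat).
Implicit Type x : 'M[K]_(m, n).

Lemma mx_norm_attained x : x != 0 -> exists ij, `|x| = `|x ij.1 ij.2|.
Proof.
move=> x0; apply: mx_norm_neq0; apply: contra_neq x0.
exact: mx_norm_eq0.
Qed.

Lemma mx_norm_le x e : 0 <= e -> (forall i j, `|x i j| <= e) -> `|x| <= e.
Proof.
move=> e0 xe; have [->|/mx_norm_attained[ij ->]] := eqVneq x 0; last exact: xe.
by rewrite normr0.
Qed.

Lemma mx_entry_le x i j : `|x i j| <= `|x|.
Proof.
rewrite [leRHS]/Num.Def.normr /= mx_normE.
apply: le_trans (_ : (widen_itv `|x i j|%:itv : {nonneg K})%:num <= _) => //.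
rewrite num_le.
exact: (le_bigmax _ (fun ij : 'I_m * 'I_n => widen_itv `|x ij.1 ij.2|%:itv) (i, j)).
Qed.

End MatrixNorm.

Section EntireInterpolation.
Variables (R : realType) (n : nat).
Local Notation C := R[i].
Local Notation V := 'cV[C]_n.
Implicit Types (x : V).

Lemma archimedean_half (b : C) : 0 <= b -> exists l, b * 2^-1 ^+ l <= 1.
Proof.
move=> b0; have bE : b = (complex.Re b)%:C by rewrite RRe_real// ger0_real.
have b0' : 0 <= complex.Re b by rewrite -ler0c -bE.
exists (Num.Def.archi_bound (complex.Re b)).
rewrite exprVn ler_pdivrMr ?exprn_gt0// mul1r bE -[2]/(2%:R) -(rmorph_nat (real_complex R)).
by rewrite -rmorphXn /= lecR ltW// upper_nthrootP.
Qed.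

Lemma le_nat_complex (x : C) : 0 <= x -> exists N, x <= N%:R.
Proof.
move=> x0; have [l] := archimedean_half x0; rewrite exprVn ler_pdivrMr ?exprn_gt0// mul1r.
by exists (2 ^ l)%N; rewrite natrX.
Qed.

Lemma majorized_coord i (s : C) :
  majorized (fun r => 3 * (`|s| * (r + 1))) (fun x => s * x i 0).
Proof.
have lin : linear (fun x : V => s * x i 0).
  by move=> a x y; rewrite !mxE mulrDr; congr (_ + _); rewrite mulrCA.
pose l : {linear V -> C} := HB.pack (fun x : V => s * x i 0)
  (GRing.isLinear.Build C V C *:%R _ lin).
have -> : (fun x => s * x i 0) = l by [].
apply: majorized_linear => // d.
by rewrite normrM ler_wpM2l//; exact: mx_entry_le.
Qed.

(** One affine factor for each point [d i] to be avoided, in a coordinate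
    that separates it from [d k]. *)
Lemma vanishing_polynomial (d : nat -> V) k c : injective d ->
  forall j, (j <= k)%N -> exists N (Q : V -> C), [/\ majorized N Q,
    forall i, (i < j)%N -> Q (d i) = 0 & Q (d k) = c].
Proof.
move=> injd; elim=> [|j IHj] jk.
  by exists (fun=> 3 * `|c|), (fun=> c); split=> //; exact: majorized_cst.
have [N [Q [QN Q0 Qk]]] := IHj (ltnW jk).
have [i dkj] : exists i, d k i 0 != d j i 0.
  apply/existsP; rewrite -negb_forall; apply/negP => /forallP dE.
  have /injd kj : d k = d j by apply/colP => i; apply/eqP.
  by move: jk; rewrite kj ltnn.
pose s := (d k i 0 - d j i 0)^-1.
exists (fun r => (3 * (`|s| * (r + 1)) + 3 * `|- (s * d j i 0)|) * N r).
exists (fun x => (s * x i 0 - s * d j i 0) * Q x); split.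
- apply: majorizedM => //; apply: majorizedD; first exact: majorized_coord.
  exact: majorized_cst.
- move=> l; rewrite ltnS leq_eqVlt => /predU1P[->|lj]; first by rewrite subrr mul0r.
  by rewrite Q0// mulr0.
- by rewrite -mulrBr mulVf ?subr_eq0// mul1r.
Qed.

(** The polynomial of [vanishing_polynomial] is multiplied by a high power of
    [x i 0 / d k i 0], where [i] is a coordinate in which [d k] attains its norm: this
    power is [1] at [d k], and its two-jet is at most a constant times
    [2^-1 ^+ m] on the balls of radius [r] with [6 * (r + 1) <= `|d k|]. *)
Lemma interpolation_step (d : nat -> V) k c : injective d ->
  exists (P : V -> C) L, [/\
    (forall z, linear (L z)) /\ (forall r, exists a, jet_bound r a P L),
    forall i, (i < k)%N -> P (d i) = 0, P (d k) = c &
    forall r, 6 * (r + 1) <= `|d k| -> jet_bound r (2^-1 ^+ k) P L].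
Proof.
move=> injd; have [N [Q [QN Q0 Qk]]] := vanishing_polynomial c injd (leqnn k).
have vac (f : V -> C) L r a : ~~ (0 <= r) -> jet_bound r a f L.
  by move=> /negP r0 y z yr; case: r0; exact: le_trans yr.
(* The largest radius concerned; if it is negative there is nothing to make
   small and the polynomial Q itself will do. *)
pose rho := `|d k| / 6 - 1.
have rhoP r : 6 * (r + 1) <= `|d k| -> r <= rho.
  by move=> h; rewrite lerBrDr ler_pdivlMr// mulrC.
have [rho0|rho0] := boolP (0 <= rho); last first.
  have [L linL QL] := QN; exists Q, L; split=> //.
  - split=> // r; exists (N r); have [r0|r0] := boolP (0 <= r); last exact: vac.
    by have [] := QL r r0.
  - move=> r /rhoP rr; apply: vac; apply: contra rho0 => r0; exact: le_trans rr.
have dk6 : 6 <= `|d k|.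
  by move: rho0; rewrite subr_ge0 ler_pdivlMr// mul1r.
have dk0 : 0 < `|d k| by apply: lt_le_trans dk6.
have [[i i0] /= dkE] : exists ij, `|d k| = `|d k ij.1 ij.2|.
  by apply: mx_norm_attained; rewrite -normr_gt0.
rewrite (ord1 i0) in dkE.
have dki0 : d k i 0 != 0 by rewrite -normr_gt0 -dkE.
have [L0 _ QL0] := QN; have [N0 _] := QL0 rho rho0.
(* 2^-1 ^+ l absorbs the bound of Q, and 2^-1 ^+ k remains. *)
have [l Nl] := @archimedean_half (N rho * 3) (mulr_ge0 N0 (ler0n _ _)).
have [L linL PL] := majorizedM QN (majorizedX (k + l) (majorized_coord i (d k i 0)^-1)).
exists (fun x => Q x * ((d k i 0)^-1 * x i 0) ^+ (k + l)), L; split.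
- split=> // r; have [r0|r0] := boolP (0 <= r); last by exists 0; exact: vac.
  by have [_ h] := PL r r0; eexists; exact: h.
- by move=> j jk; rewrite Q0// mul0r.
- by rewrite mulVf// expr1n mulr1.
move=> r /rhoP rr; have [_] := PL rho rho0; apply: jet_bound_le => //.
rewrite normfV -dkE /rho subrK.
have -> : 3 * (`|d k|^-1 * (`|d k| / 6)) = 2^-1.
  by rewrite mulKf ?gt_eqF//; field.
have -> : N rho * (3 * 2^-1 ^+ (k + l)) = N rho * 3 * 2^-1 ^+ l * 2^-1 ^+ k.
  by rewrite exprD; ring.
by rewrite -[leRHS]mul1r; apply: ler_wpM2r; rewrite ?exprn_ge0 ?invr_ge0.
Qed.

End EntireInterpolation.

(** * Interpolation by entire functions *)

Lemma cvg_norm_le (K : numFieldType) (V : normedModType K) (u : nat -> V) l b k0 :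
  u @ \oo --> l -> (forall k, (k0 <= k)%N -> `|u k| <= b) -> `|l| <= b.
Proof.
move=> ul ub; have b0 : 0 <= b := le_trans (normr_ge0 _) (ub k0 (leqnn _)).
rewrite real_leNgt ?ger0_real//; apply/negP => bl.
have e0 : 0 < `|l| - b by rewrite subr_gt0.
have /cvgrPdist_lt/(_ _ e0)[k1 _ k1P] := ul.
have k1M : (k1 <= maxn k0 k1)%N by exact: leq_maxr.
have := ltr_leD (k1P _ k1M) (ub _ (leq_maxl k0 k1)); rewrite subrK.
by move=> /(le_lt_trans (ler_normD _ _)); rewrite subrK ltxx.
Qed.

Section EntireInterpolation.
Variables (R : realType).
Local Notation C := ((R[i] : numFieldType) : Type).

Lemma geometric_cvg (u : nat -> C) k0 b : 0 <= b ->
  (forall k, (k0 <= k)%N -> `|u k.+1 - u k| <= b * 2^-1 ^+ k) ->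
  exists l : C, u @ \oo --> l.
Proof.
move=> b0 ub; have b1 : 0 < b + 1 by rewrite ltr_wpDl.
have half0 k : 0 <= 2^-1 ^+ k :> C by rewrite exprn_ge0// invr_ge0.
have [k k0k|l lP] := @geometric_cauchy _ (fun k => u k / (b + 1)) k0.
  rewrite -mulrBl normrM [X in _ * X]ger0_norm ?invr_ge0 ?(ltW b1)//.
  rewrite ler_pdivrMr//; apply: le_trans (ub k k0k) _.
  by rewrite mulrC ler_wpM2l// lerDl.
exists (l * (b + 1)); apply/cvgrPdist_le => e e0.
have [j jP] := @archimedean_half _ ((b + 1) * 4 / e)
  (divr_ge0 (mulr_ge0 (ltW b1) (ler0n _ 4)) (ltW e0)).
exists (maxn k0 j) => // k /=; rewrite geq_max => /andP[k0k jk].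
have := lP k k0k; rewrite distrC -(ler_pM2r b1).
rewrite -[X in _ * X <= _](ger0_norm (ltW b1)) -normrM mulrBl divfK ?gt_eqF//.
move=> h; apply: le_trans h _.
move: jP; rewrite mulrAC ler_pdivrMr// mul1r => jP; apply: le_trans jP.
rewrite mulrC mulrA ler_wpM2l ?mulr_ge0 ?(ltW b1)//.
by rewrite -(subnKC jk) exprD ler_piMr// exprn_ile1// ?invr_ge0 ?invf_le1 ?ler1n.
Qed.

(** The successive polynomials of [interpolation_step] correct the value at [d k]
    without changing the values at the previous points.  On every ball their
    two-jets are eventually bounded by [2^-1 ^+ k], so the partial sums and their
    derivatives converge and satisfy a uniform second-order estimate, which
    passes to the limit. *)
Theorem entire_interpolation n (d : nat -> 'cV[C]_n) (w : nat -> C) : injective d ->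
  (forall N : nat, exists k0, forall k, (k0 <= k)%N -> N%:R <= `|d k|) ->
  exists f : 'cV[C]_n -> C, (forall z, differentiable f z) /\ forall k, f (d k) = w k.
Proof.
move=> injd dinf; pose V := 'cV[C]_n.
have [F FP] := choice (fun kc : nat * C =>
  let: ex_intro P (ex_intro L PL) := interpolation_step kc.1 kc.2 injd in
  ex_intro (fun p : (V -> C) * (V -> V -> C) => [/\
    (forall z, linear (p.2 z)) /\ (forall r, exists a, jet_bound r a p.1 p.2),
    forall i, (i < kc.1)%N -> p.1 (d i) = 0, p.1 (d kc.1) = kc.2 &
    forall r, 6 * (r + 1) <= `|d kc.1| -> jet_bound r (2^-1 ^+ kc.1) p.1 p.2]) (P, L) PL).
(* F (k, c) is a correction with value c at d k; S k is the k-th partial sum,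
   paired with its derivative. *)
pose step k (S : (V -> C) * (V -> V -> C)) := F (k, w k - S.1 (d k)).
pose fix S k : (V -> C) * (V -> V -> C) := if k is j.+1 then
  (fun x => (S j).1 x + (step j (S j)).1 x, fun z y => (S j).2 z y + (step j (S j)).2 z y)
  else (fun=> 0, fun _ _ => 0).
have stepP k := FP (k, w k - (S k).1 (d k)).
have Sd k j : (j < k)%N -> (S k).1 (d j) = w j.
  elim: k => // k IHk; rewrite ltnS leq_eqVlt /=; have [_ P0 Pk _] := stepP k.
  case/predU1P => [->|jk]; first by rewrite [X in _ + X]Pk addrC subrK.
  by rewrite IHk// [X in _ + X]P0// addr0.
have Slin k z : linear ((S k).2 z).
  elim: k => [|k IHk] a x y /=; first by rewrite scaler0 addr0.
  by have [[Plin _] _ _ _] := stepP k; rewrite IHk Plin scalerDr addrACA.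
have Sjet k r : exists a, jet_bound r a (S k).1 (S k).2.
  elim: k => [|k [a IHk]]; first by eexists; exact: jet_bound_cst.
  have [[_ /(_ r)[b Pb]] _ _ _] := stepP k; exists (a + b); exact: jet_boundD.
have tail N : exists k0, forall k, (k0 <= k)%N ->
    jet_bound N%:R (2^-1 ^+ k) (step k (S k)).1 (step k (S k)).2.
  (* The condition on the radius N in interpolation_step. *)
  have [k0 k0P] := dinf (6 * (N + 1))%N; exists k0 => k /k0P dk.
  have [_ _ _] := stepP k; apply; move: dk.
  by rewrite natrM natrD.
have half0 k : 0 <= 2^-1 ^+ k :> C by rewrite exprn_ge0// invr_ge0.
have Sunif N : exists A k0, forall k, (k0 <= k)%N -> jet_bound N%:R A (S k).1 (S k).2.
  have [k0 k0P] := tail N; have [a aP] := Sjet k0 N%:R.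
  (* 2 bounds the sum of the tail, here in a form suited to induction. *)
  exists (a + 2), k0 => k k0k; rewrite -(subnKC k0k).
  apply: (@jet_bound_le _ _ N%:R N%:R (a + 2) (a + 2 - 2 * 2^-1 ^+ (k - k0))) => //.
    by rewrite gerBl mulr_ge0.
  elim: (k - k0)%N => [|j IHj]; first by rewrite addn0 expr0 mulr1 addrK.
  rewrite addnS /=; have := k0P (k0 + j)%N (leq_addr _ _).
  move=> /(jet_bound_le (lexx _))-/(_ (2^-1 ^+ j)) Pj.
  have -> : a + 2 - 2 * 2^-1 ^+ j.+1 = a + 2 - 2 * 2^-1 ^+ j + 2^-1 ^+ j :> C.
    by rewrite exprS; field.
  apply: jet_boundD => //; apply: Pj.
  by rewrite exprD ler_piMl// exprn_ile1// ?invr_ge0 ?invf_le1 ?ler1n.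
have third k : 2^-1 ^+ k / 3 <= 2^-1 ^+ k :> C.
  by rewrite ler_piMr// invf_le1// ler1n.
have lim1 z : exists l : C, (fun k => (S k).1 z) @ \oo --> l.
  have [N zN] := le_nat_complex (normr_ge0 z).
  have [k0 k0P] := tail N; apply: (@geometric_cvg _ k0 1) => // k k0k.
  rewrite /= addrC addKr mul1r; have [h _ _ _] := k0P k k0k z z zN zN.
  exact: le_trans h (third k).
have lim2 (zy : V * V) : exists l : C, (fun k => (S k).2 zy.1 zy.2) @ \oo --> l.
  case: zy => z y; have [N zN] := le_nat_complex (normr_ge0 z).
  have [k0 k0P] := tail N; apply: (@geometric_cvg _ k0 `|y|) => // k k0k.
  rewrite /= addrC addKr; have [_ h _ _] := k0P k k0k z z zN zN; apply: le_trans (h y) _.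
  by rewrite mulrC; apply: ler_wpM2l (third k).
have [f fP] := choice lim1; have [L' L'P] := choice lim2.
pose L z y := L' (z, y).
have LP z y : (fun k => (S k).2 z y) @ \oo --> L z y := L'P (z, y).
exists f; split=> [z|k]; last first.
  apply: (cvg_unique (@norm_hausdorff _ _) (fP (d k))).
  apply: (cvg_near_cst (w k)); exists k.+1 => // j /= kj; exact: Sd.
have Llin : linear (L z).
  move=> a x y; apply: (cvg_unique (@norm_hausdorff _ _) (LP z (a *: x + y))).
  have -> : (fun k => (S k).2 z (a *: x + y)) =
      (fun k => a * (S k).2 z x) + (fun k => (S k).2 z y).
    by apply/funext => k; exact: Slin.
  by apply: cvgD; [apply: cvgMl_tmp|]; exact: LP.
(* This ball contains the unit ball around z. *)
have [N zN] := @le_nat_complex R (`|z| + 1) (addr_ge0 (normr_ge0 _) ler01).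
have [A [k0 k0P]] := Sunif N.
have zN' : `|z| <= N%:R by apply: le_trans zN; rewrite lerDl.
apply: (@quadratic_differentiable _ _ _ f z (L z) (A / 3)) => //.
- by have [h _ _ _] := k0P k0 (leqnn _) z z zN' zN'; exact: le_trans h.
- move=> y; apply: (cvg_norm_le (LP z y)) => k k0k.
  by have [_ h _ _] := k0P k k0k z z zN' zN'; exact: h.
move=> y yz; have yN : `|y| <= N%:R.
  apply: le_trans zN; rewrite -[y](subrK z) addrC.
  by apply: le_trans (ler_normD _ _) _; rewrite lerD2l.
apply: (@cvg_norm_le _ _ (fun k => (S k).1 y - (S k).1 z - (S k).2 z (y - z)) _ _ k0).
  by apply: cvgB; [apply: cvgB|].
by move=> k k0k; have [_ _ _ h] := k0P k k0k y z yN zN'.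
Qed.
End EntireInterpolation.

(** * Discrete sets of complex matrices *)

Section ComplexTopology.
Variable R : realType.
Local Notation C := ((R[i] : numFieldType) : Type).

Lemma compact_norm_bounded (V : normedModType C) (A : set V) :
  compact A -> exists N : nat, forall x, A x -> `|x| <= N%:R.
Proof.
move=> /compact_near_coveringP /(_ nat \oo (fun N x => `|x| <= N%:R) _)[x _|N _ NP].
  have [N xN] := le_nat_complex (addr_ge0 (normr_ge0 x) ler01).
  exists ([set y | `|x - y| <= 1], [set k | (N <= k)%N]) => /= [|[y k] /= [xy Nk]].
    by split; [exact: cvgr_dist_le|exact: nbhs_infty_ge].
  apply: (@le_trans _ _ (N%:R : C)); last by rewrite ler_nat.
  apply: le_trans xN; rewrite -[y](subrK x) addrC.
  by apply: le_trans (ler_normD _ _) _; rewrite lerD2l distrC.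
by exists N => x Ax; exact: (NP N (leqnn N)).
Qed.

Lemma compact_complex_box (M : R) :
  compact ((fun p : R * R => (p.1 +i* p.2 : C)) @` (`[-M, M] `*` `[-M, M])).
Proof.
apply: continuous_compact; last by apply: compact_setX; exact: segment_compact.
apply: continuous_subspaceT => p; apply/cvgrPdist_le => e e0.
have eE : e = (complex.Re e)%:C by rewrite RRe_real// gtr0_real.
have e2 : 0 < complex.Re e / 2 by rewrite divr_gt0// -ltcR -eE.
near=> q.
have -> : p.1 +i* p.2 - (q.1 +i* q.2) = (p.1 - q.1) +i* (p.2 - q.2) :> C by [].
apply: le_trans (norm_le_ReIm _ _) _; rewrite eE lecR [leRHS]splitr lerD//.
  by near: q; apply: (cvgr_dist_le _ _ _ _ e2); exact: cvg_fst.
by near: q; apply: (cvgr_dist_le _ _ _ _ e2); exact: cvg_snd.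
Unshelve. all: by end_near. Qed.

(** The image of a product of squares of the complex plane under a continuous
    map; each square is itself an image of a product of real segments. *)
Lemma compact_matrix_ball m n (N : nat) :
  exists2 B : set 'M[C]_(m, n), compact B & forall A, `|A| <= N%:R -> B A.
Proof.
pose box := (fun p : R * R => (p.1 +i* p.2 : C)) @` (`[- N%:R, N%:R] `*` `[- N%:R, N%:R]).
exists (vec_mx @` [set v : 'rV[C]_(m * n) | forall i, box (v ord0 i)]).
  apply: continuous_compact; last first.
    by apply: (rV_compact (A := fun=> box)) => _; exact: compact_complex_box.
  apply: continuous_subspaceT.
  apply: (@linear_le_continuous R[i] _ _
    (vec_mx : {linear 'rV[C]_(m * n) -> 'M[C]_(m, n)}) 1) => // v.
  rewrite mul1r.
  apply: mx_norm_le => // i j; rewrite mxE; exact: mx_entry_le.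
move=> A AN; exists (mxvec A); last exact: mxvecK.
move=> k; case/mxvec_indexP: k => i j; rewrite mxvecE.
have Aij : `|A i j : C| <= (N%:R)%:C.
  by rewrite rmorph_nat; apply: le_trans AN; exact: mx_entry_le.
exists (complex.Re (A i j), complex.Im (A i j)); last by case: (A i j).
split; rewrite /= in_itv /= -ler_norml -lecR; apply: le_trans Aij.
  exact: normc_ge_Re.
exact: norm_ge_Im.
Qed.

(** Every point has a neighbourhood that meets [D] at most in that point, and
    finitely many of these cover a ball. *)
Lemma finite_bounded_discrete m n (D : set 'M[C]_(m, n)) (N : nat) :
  (forall A, ~ limit_point D A) -> finite_set (D `&` [set A | `|A| <= N%:R]).
Proof.
move=> noL; have [B cB BN] := compact_matrix_ball m n N.
have /choice[U UP] : forall A, exists U : set 'M[C]_(m, n),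
    [/\ open U, U A & D `&` U `<=` [set A]].
  move=> A; apply: contrapT => nU; apply: (noL A) => U /nbhs_interior.
  move=> UA; apply: contrapT => nE; apply: nU; exists U^°; split.
  - exact: open_interior.
  - exact: nbhs_singleton.
  - move=> y [Dy /interior_subset Uy]; apply: contrapT => yA; apply: nE.
    by exists y; split => //; apply/eqP.
move: cB; rewrite compact_cover => /(_ _ setT U) [A _|A _|F _ BF].
- by have [] := UP A.
- by exists A => //; have [] := UP A.
apply: sub_finite_set (finite_fset F).
move=> A [DA /BN /BF[A' FA' UA]]; have [_ _ /(_ A (conj DA UA)) AA'] := UP A'.
by rewrite AA'.
Qed.

Lemma continuous_meval n (p : mpoly (n * n) C) :
  continuous (fun A : 'M[C]_n => (meval (fun k => mxvec A 0 k) p : C)).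
Proof.
under eq_fun do rewrite mevalE.
move=> A; have FA : Filter (nbhs A) by exact: nbhs_filter.
apply: cvg_big => [|m _]; first exact: add_continuous.
apply: cvgM; first exact: cst_continuous.
apply: cvg_big => [|k _]; first exact: mul_continuous.
case/mxvec_indexP: k => i j; under eq_fun do rewrite mxvecE.
rewrite mxvecE.
elim: (fun_of_multinom m _) => [|d IHd].
  by under eq_fun do rewrite expr0; rewrite expr0; exact: cst_continuous.
under eq_fun do rewrite exprS; rewrite exprS.
by apply: cvgM; [exact: coord_continuous|exact: IHd].
Qed.

Lemma zariski_closed_closed n (Z : set 'M[C]_n) : zariski_closed Z -> closed Z.
Proof.
move=> [S ->].
have -> : [set A : 'M[C]_n | forall p, S p -> meval (fun k => mxvec A 0 k) p = 0] =
   \bigcap_(p in S) ((fun A : 'M[C]_n => (meval (fun k => mxvec A 0 k) p : C)) @^-1` [set 0]).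
  by apply/seteqP; split.
apply: closed_bigI => p Sp; apply: preimage_closed.
  by move=> A _; exact: continuous_meval.
by apply: accessible_closed_set1; apply: hausdorff_accessible; exact: norm_hausdorff.
Qed.

Lemma enumerate_discrete m n (D : set 'M[C]_(m, n)) : infinite_set D ->
  (forall A, ~ limit_point D A) ->
  exists e : nat -> 'M[C]_(m, n), [/\ injective e, range e = D &
    forall N : nat, exists k0, forall k, (k0 <= k)%N -> N%:R <= `|e k|].
Proof.
move=> infD noL.
have finD N := finite_bounded_discrete N noL.
have countD : countable D.
  rewrite (_ : D = \bigcup_(N in [set: nat]) (D `&` [set A | `|A| <= N%:R])).
    by apply: bigcup_countable => // N _; exact: finite_set_countable.
  apply/seteqP; split=> [A DA|A [N _ []//]].
  by have [N AN] := le_nat_complex (normr_ge0 A); exists N.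
have : ([set: nat] #= D)%card by rewrite card_eq_sym; exact: eq_card_nat.
move=> /pcard_eqP[e].
have inje : injective e by move=> i j /inj; apply; rewrite inE.
exists e; split => //; first exact: image_eq.
move=> N; have /finite_seqP[s sE] : finite_set (e @^-1` (D `&` [set A | `|A| <= N%:R])).
  by apply: finite_preimage => // i j _ _; exact: inje.
exists (\max_(i <- s) i).+1 => k sk; apply/ltW.
rewrite real_ltNge ?ger0_real//; apply/negP => ekN.
have ks : k \in s.
  have : (e @^-1` (D `&` [set A | `|A| <= N%:R])) k.
    by split => //; exact: funS.
  by rewrite sE.
have := @leq_bigmax_seq _ s xpredT id k ks isT.
by rewrite leqNgt sk.
Qed.

End ComplexTopology.

(** * Shears of the special linear group *)

(** Two triangular factorizations of the same block matrix. *)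
Lemma det_1addM (F : comNzRingType) m n (A : 'M[F]_(m, n)) (B : 'M[F]_(n, m)) :
  \det (1%:M + A *m B) = \det (1%:M + B *m A).
Proof.
pose X := block_mx (1%:M : 'M[F]_n) (- B) A (1%:M : 'M[F]_m).
have -> : \det (1%:M + A *m B) = \det X.
  have -> : X = block_mx 1%:M 0 A 1%:M *m block_mx 1%:M (- B) 0 (1%:M + A *m B).
    rewrite mulmx_block !mul1mx !mul0mx !mulmx1 !addr0 mulmxN.
    by rewrite [- _ + _]addrC addrK.
  by rewrite det_mulmx det_lblock det_ublock !det1 !mul1r.
have -> : X = block_mx (1%:M + B *m A) (- B) 0 1%:M *m block_mx 1%:M 0 A 1%:M.
  by rewrite mulmx_block !mul1mx !mul0mx !mulmx1 !mulmx0 !add0r mulNmx addrK.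
by rewrite det_mulmx det_lblock det_ublock !det1 !mulr1.
Qed.

Lemma mx_norm_mul_le (K : numFieldType) m n p (A : 'M[K]_(m, n)) (B : 'M[K]_(n, p)) :
  `|A *m B| <= n%:R * `|A| * `|B|.
Proof.
apply: mx_norm_le => [|i j]; first by rewrite !mulr_ge0.
rewrite mxE; apply: le_trans (ler_norm_sum _ _ _) _.
apply: le_trans (_ : \sum_(k < n) `|A| * `|B| <= _).
  by apply: ler_sum => k _; rewrite normrM ler_pM// mx_entry_le.
by rewrite sumr_const card_ord -[leLHS]mulr_natl mulrA.
Qed.

Section Shear.
Variables (R : realType) (n : nat).
Local Notation C := ((R[i] : numFieldType) : Type).
Variables (v : 'cV[C]_n) (u : 'rV[C]_n).
Hypothesis uv : u *m v = 0.

(** Right multiplication of [A] by [1 + f (A *m v) *: (v *m u)]. *)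
Definition shear (f : 'cV[C]_n -> C) (A : 'M[C]_n) : 'M[C]_n :=
  A + f (A *m v) *: (A *m v *m u).

(** Since [u *m v = 0], the argument of [f] is invariant under the shear; hence the
    shears along [v] and [u] compose by adding the functions. *)
Lemma shear_mulmx f A : shear f A *m v = A *m v.
Proof. by rewrite mulmxDl -scalemxAl -(mulmxA (A *m v)) uv mulmx0 scaler0 addr0. Qed.

Lemma shearK f : cancel (shear f) (shear (fun x => - f x)).
Proof. by move=> A; rewrite {1}/shear shear_mulmx scaleNr addrK. Qed.

Lemma det_shear f A : \det (shear f A) = \det A.
Proof.
have -> : shear f A = A *m (1%:M + (f (A *m v) *: v) *m u).
  by rewrite mulmxDr mulmx1 -scalemxAl -scalemxAr mulmxA.
by rewrite det_mulmx det_1addM -scalemxAr uv scaler0 addr0 det1 mulr1.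
Qed.

Lemma differentiable_shear f : (forall x, differentiable f x) ->
  forall A, differentiable (shear f) A.
Proof.
move=> df A.
have dv B : differentiable (fun B : 'M[C]_n => B *m v) B.
  pose l : {linear 'M[C]_n -> 'cV[C]_n} := mulmxr v.
  apply: (@linear_differentiable _ _ _ l).
  apply: (@linear_le_continuous _ _ _ l (n%:R * `|v|)) => [|D].
    by rewrite mulr_ge0.
  by rewrite mulrAC; exact: mx_norm_mul_le.
have -> : shear f = id + \sum_(i < n) \sum_(j < n)
    (fun B => (f (B *m v) * ((B *m v) i 0 * u 0 j)) *: (delta_mx i j : 'M[C]_n)).
  apply/funext => B; rewrite /shear; congr (_ + _).
  rewrite [LHS]matrix_sum_delta fct_sumE; apply: eq_bigr => i _.
  rewrite fct_sumE; apply: eq_bigr => j _; congr (_ *: _).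
  by rewrite mxE; congr (_ * _); rewrite mxE big_ord1.
apply: differentiableD; first exact: ex_diff.
apply: differentiable_sum => i; apply: differentiable_sum => j.
apply: differentiableZl; apply: differentiableM.
  exact: differentiable_comp (dv A) (df _).
apply: differentiableM; last exact: differentiable_cst.
exact: differentiable_comp (dv A) (differentiable_coord _ _ _).
Qed.

Lemma shear_automorphism f : (forall x, differentiable f x) ->
  automorphism (SL R n) (shear f).
Proof.
move=> df; have dNf x : differentiable (fun x => - f x) x by exact: differentiableN.
exists (shear (fun x => - f x)); split.
- by split=> A; rewrite /SL /= det_shear.
- split=> A _; first exact: shearK.
  have := shearK (fun x => - f x) A.
  by rewrite (_ : (fun _ => _) = f)//; apply/funext => x; rewrite opprK.
- move=> A _; exists (shear f); split; last exact: filterE.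
  by apply: filterE => y; exact: differentiable_shear.
move=> A _; exists (shear (fun x => - f x)); split; last exact: filterE.
by apply: filterE => y; exact: differentiable_shear.
Qed.

End Shear.

Lemma left_annihilator_exists (F : fieldType) n (v : 'cV[F]_n.+2) :
  exists2 u : 'rV[F]_n.+2, u != 0 & u *m v = 0.
Proof.
have /rowV0Pn[u uv u0] : kermx v != 0.
  rewrite kermx_eq0 /row_free; apply/negP => /eqP rv.
  by have := rank_leq_col v; rewrite rv.
by exists u => //; apply/sub_kermxP.
Qed.

(** SL_0 and SL_1 are single points. *)
Lemma infinite_SL_size (R : realType) n (D : set 'M[R[i]]_n) :
  D `<=` SL R n -> infinite_set D -> exists m, n = m.+2.
Proof.
case: n D => [|[|n]] D DSL infD; last by exists n.
- case: infD; apply: sub_finite_set (finite_set1 (1%:M : 'M[R[i]]_0)) => A _ /=.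
  by apply/matrixP => -[].
case: infD; apply: sub_finite_set (finite_set1 (1%:M : 'M[R[i]]_1)) => A /DSL /=.
by rewrite /SL /= det_mx11 => A1; apply/matrixP => i j; rewrite !ord1 mxE A1.
Qed.

(** The formula of [torus_orbit] expresses [A] linearly in terms of [A *m v]. *)
Lemma torus_orbit_proper (R : realType) n (T : set 'M[R[i]]_n.+1) : torus T ->
  exists (v : 'cV[R[i]]_n.+1) c, [/\ v != 0, 0 <= c, {in T &, injective (mulmx^~ v)} &
    forall A, T A -> `|A| <= c * `|A *m v|].
Proof.
move=> /torus_orbit[P [v [Pu v0 TE]]].
exists v, (n.+1%:R * (n.+1%:R * `|invmx P| * (n.+1%:R * `|P|)) * `|P|); split; first exact: v0.
  - by rewrite !mulr_ge0.
  - move=> A B /set_mem TA /set_mem TB /= ABv.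
    by rewrite [LHS](TE A TA) [RHS](TE B TB) ABv.
move=> A TA; rewrite {1}(TE A TA).
have dle : `|diag_mx (P *m (A *m v))^T| <= n.+1%:R * `|P| * `|A *m v|.
  apply: le_trans (mx_norm_mul_le _ _).
  apply: mx_norm_le => // i j; rewrite !mxE mulrb.
  case: ifP => _; last by rewrite normr0.
  by have := mx_entry_le (P *m (A *m v)) i 0; rewrite mxE.
apply: le_trans (mx_norm_mul_le _ _) _.
have -> : forall a b c d e : R[i], a * (a * b * (a * c)) * d * e = a * (a * b * (a * c * e)) * d.
  by move=> *; ring.
apply: ler_wpM2r => //; apply: ler_wpM2l => //.
by apply: le_trans (mx_norm_mul_le _ _) _; apply: ler_wpM2l => //; rewrite mulr_ge0.
Qed.

(** * Tameness *)

Theorem corollary10p10 (R : realType) (n : nat) (T D : set 'M[R[i]]_n) :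
  torus T -> infinite_set D -> discrete_subset T D -> tame (SL R n) D.
Proof.
move=> torT infD [DT discD]; have [[[TSL _ _ _] Tzar] _ _] := torT.
have DSL : D `<=` SL R n by move=> A /DT /TSL.
have noL A : ~ limit_point (D : set 'M[(R[i] : numFieldType)]_n) A.
  move=> DA; apply: (discD A) => //.
  have /closure_id -> := zariski_closed_closed Tzar.
  exact: closure_subset DT _ (subset_limit_point DA).
have [m nE] := infinite_SL_size DSL infD; subst n.
split=> // rho zeta [_ _ rhoK] _.
have [v [c [v0 c0 vinj cv]]] := torus_orbit_proper torT.
have [u u0 uv] := left_annihilator_exists v.
have [e [einj De einf]] := enumerate_discrete infD noL.
have Te k : T (e k) by apply: DT; rewrite -De; exists k.
pose d k := e k *m v.
have dinj : injective d.
  by move=> i j /vinj eij; apply: einj; apply: eij; exact: mem_set.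
have dinf (N : nat) : exists k0, forall k, (k0 <= k)%N -> N%:R <= `|d k|.
  have [B cB] := le_nat_complex c0.
  have [k0 k0P] := einf ((B.+1) * N)%N; exists k0 => k /k0P ek.
  have B1 : 0 < B.+1%:R :> R[i] by rewrite ltr0n.
  rewrite -(ler_pM2l B1) -natrM; apply: le_trans ek _.
  apply: le_trans (cv _ (Te k)) _.
  apply: ler_wpM2r => //; apply: le_trans cB _; rewrite ler_nat; exact: leqnSn.
have /choice[M MP] k : exists M : nat, forall A, SL R m.+2 A -> rho A <= zeta (e k) -> `|A| <= M%:R.
  have [M MP] := compact_norm_bounded (rhoK (zeta (e k))).
  by exists M => A SA rA; apply: MP.
have du k : d k *m u != 0.
  have dk0 : d k != 0.
    apply: contra_neq v0 => dk0.
    have eu : e k \in unitmx by rewrite unitmxE (TSL _ (Te k)) unitr1.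
    by rewrite -[v](mulKmx eu) -/(d k) dk0 mulmx0.
  have /matrix0Pn[i [j dkij]] := dk0; have /matrix0Pn[i' [j' uij]] := u0.
  rewrite (ord1 j) in dkij; rewrite (ord1 i') in uij.
  by apply/matrix0Pn; exists i, j'; rewrite mxE big_ord1 mulf_neq0.
(* The shear adds to e k a matrix of norm (M k).+1 + |e k|. *)
have [f [df fd]] := entire_interpolation
  (fun k => ((M k).+1%:R + `|e k|) / `|d k *m u|) dinj dinf.
exists (shear v u f); first exact: shear_automorphism.
move=> A; rewrite -De => -[k _ <-]; rewrite leNgt; apply/negP => /ltW rk.
have := MP k (shear v u f (e k)); rewrite /SL /= det_shear// => /(_ (TSL _ (Te k)) rk).
apply/negP; rewrite -real_ltNge ?ger0_real//.
have duk : 0 < `|d k *m u| by rewrite normr_gt0.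
apply: (@lt_le_trans _ _ ((M k).+1%:R)); first by rewrite ltr_nat.
rewrite -(lerD2r `|e k|).
have -> : (M k).+1%:R + `|e k| = `|f (d k) *: (d k *m u)|.
  rewrite normrZ fd ger0_norm; first by rewrite divfK ?gt_eqF.
  by rewrite divr_ge0// addr_ge0.
have -> : f (d k) *: (d k *m u) = shear v u f (e k) - e k.
  by rewrite /shear addrC addKr.
exact: ler_normB.
Qed.
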